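(* Let $a\in\mathcal{H}$ have polynomial growth and suppose that $|a(x)-cp(x)|\to\infty$ as $x\to\infty$ for every $p\in\mathbb{Z}[x]$ and $c\in\mathbb{R}$. Then $S=\{[a(1)],[a(2)],\ldots\}$ is a set of single recurrence.
   Context: $\mathbb{N}=\{1,2,\ldots\}$; $[x]$ is the integer part of $x$. Hardy fields: let $B$ be the ring (pointwise operations) of equivalence classes of real valued functions defined on some half line $(u,\infty)$, two functions being identified if they agree for all large $x$. A Hardy field is a subfield of $(B,+,\cdot)$ that is closed under differentiation. $\mathcal{H}$ denotes the union of all Hardy fields. Elements of $\mathcal{H}$ are treated as functions; all statements about them concern sufficiently large $x$, and $a(n)$ is considered only for those $n$ for which it is defined. The function $a$ has polynomial growth if $a(x)/x^d\to 0$ as $x\to\infty$ for some $d\in\mathbb{N}$. A system is a quadruple $(X,\mathcal{B},\mu,T)$ where $(X,\mathcal{B},\mu)$ is a Lebesgue probability space and $T\colon X\to X$ is an invertible measurable map with $\mu(T^{-1}A)=\mu(A)$ for every $A\in\mathcal{B}$. A set $S\subset\mathbb{Z}$ is a set of single recurrence (i.e. of $1$-recurrence) if for every system $(X,\mathcal{B},\mu,T)$ and every $A\in\mathcal{B}$ with $\mu(A)>0$ we have $\mu(A\cap T^{-s}A)>0$ for some non-zero $s\in S$. *)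

(* Defs.v *)
From mathcomp Require Import all_boot all_order all_algebra.
From mathcomp Require Import all_classical all_reals all_analysis.
Set Implicit Arguments.
Unset Strict Implicit.
Unset Printing Implicit Defensive.
Import Order.TTheory GRing.Theory Num.Theory.
Import numFieldNormedType.Exports.
Local Open Scope classical_set_scope.
Local Open Scope ring_scope.

Definition eventually_eq (R : realType) (f g : R -> R) : Prop :=
  \forall x \near +oo_R, f x = g x.

(* The germ at infinity of a function defined on a half line is represented by
   any total function extending it.  A subset of the ring of germs is then a set
   [F] of functions that is saturated for [eventually_eq]; the fields below say
   that this subset is a subfield, closed under differentiation.  By saturation
   the values of [derive1 f] where [f] is not derivable are irrelevant. *)
Record hardy_field (R : realType) (F : set (R -> R)) : Prop := HardyField {
  hardy_saturated : forall f g, eventually_eq f g -> F f -> F g;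
  hardy_one : F (fun=> 1);
  hardy_sub : forall f g, F f -> F g -> F (fun x => f x - g x);
  hardy_mul : forall f g, F f -> F g -> F (fun x => f x * g x);
  hardy_inv : forall f, F f -> ~ eventually_eq f (fun=> 0) ->
    exists2 g, F g & eventually_eq (fun x => f x * g x) (fun=> 1);
  hardy_derive : forall f, F f ->
    (\forall x \near +oo_R, derivable f x 1) /\ F (derive1 f)
}.

Definition hardy_union (R : realType) : set (R -> R) :=
  [set f | exists2 F, hardy_field F & F f].

Definition polynomial_growth (R : realType) (f : R -> R) : Prop :=
  exists2 d : nat, (0 < d)%N & f x / x ^+ d @[x --> +oo_R] --> 0.

Definition isomorphic_mod0 (R : realType) (d1 d2 : measure_display)
    (X : measurableType d1) (Y : measurableType d2)
    (mu : set X -> \bar R) (nu : set Y -> \bar R) : Prop :=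
  exists (M : set X) (N : set Y) (f : X -> Y),
    [/\ measurable M /\ mu (~` M) = 0%E,
        measurable N /\ nu (~` N) = 0%E,
        set_bij M N f,
        forall E, E `<=` M -> (measurable E <-> measurable (f @` E)) &
        forall E, E `<=` M -> measurable E -> mu E = nu (f @` E)].

(* The real line with the sigma-algebra of Lebesgue (not just Borel) measurable
   sets, on which [completed_lebesgue_measure] is defined. *)
Definition lebesgue_line (R : realType) : measurableType _ :=
  caratheodory_type ((wlength (@idfun R))^*)%mu.

(* Lebesgue measure on [0, s] together with atoms of mass [p n]; the disjoint
   union is realised inside the real line by placing the n-th atom at
   [- (n + 1)].  Finitely many atoms are obtained by letting [p n] vanish. *)
Definition interval_with_atoms (R : realType) (s : R) (p : nat -> R)
    (E : set (lebesgue_line R)) : \bar R :=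
  (completed_lebesgue_measure (E `&` [set x : R | (0 <= x <= s)%R]) +
   \sum_(0 <= n <oo) (p n)%:E * \d_((- n.+1%:R)%R : lebesgue_line R) E)%E.

Definition lebesgue_space (R : realType) (d : measure_display)
    (X : measurableType d) (mu : probability X R) : Prop :=
  exists (s : R) (p : nat -> R),
    [/\ 0 <= s, forall n, 0 <= p n,
        (s%:E + \sum_(0 <= n <oo) (p n)%:E = 1)%E &
        isomorphic_mod0 mu (interval_with_atoms s p)].

(* [Ti] is the inverse of the invertible map [T]. *)
Record is_system (R : realType) (d : measure_display) (X : measurableType d)
    (mu : probability X R) (T Ti : X -> X) : Prop := IsSystem {
  system_lebesgue : lebesgue_space mu;
  system_invl : cancel T Ti;
  system_invr : cancel Ti T;
  system_measurable : measurable_fun setT T;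
  system_measurable_inv : measurable_fun setT Ti;
  system_preserving : forall A, measurable A -> mu (T @^-1` A) = mu A
}.

Definition iter_int (X : Type) (T Ti : X -> X) (s : int) : X -> X :=
  match s with Posz n => iter n T | Negz n => iter n.+1 Ti end.

Definition set_of_single_recurrence (R : realType) (S : set int) : Prop :=
  forall (d : measure_display) (X : measurableType d) (mu : probability X R)
         (T Ti : X -> X),
    is_system mu T Ti ->
    forall A : set X, measurable A -> (0 < mu A)%E ->
    exists s : int,
      [/\ S s, s != 0 & (0 < mu (A `&` iter_int T Ti s @^-1` A))%E].

(* Main.v *)
Require Import Defs.
From mathcomp Require Import all_boot all_order all_algebra.
From mathcomp Require Import all_classical all_reals all_analysis.
From mathcomp Require Import measurable_realfun ring lra zify.
Import Order.TTheory GRing.Theory Num.Theory.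
Import numFieldNormedType.Exports.
Local Open Scope classical_set_scope.
Local Open Scope ring_scope.

(** Two reductions lead from recurrence to exponential sums.

    First, finitely many nonzero integers s with weights w_s force recurrence
    as soon as g(t) = \sum_s w_s cos (2 pi t s) is bounded below on [0, 1] by a
    small negative constant, compared with g(0).  If no s returned A to itself
    with positive measure, almost every orbit would visit A along a set E of
    times in which no difference equals any s; the discrete Fourier transform
    writes the (vanishing) weighted number of such differences as an average of
    |E^(z)|^2 g(z / M), whose term z = 0 is |E|^2 g(0), so that E has small
    density ([sparse_of_cos_poly], [recurrence_of_cos_poly]).

    Secondly, such weights on the integers [a(k)] come from means that tend to
    zero.  Suppose that cos (t a(k) + p) has mean tending to 0 for all real t <> 0
    and p when k runs over suitable finite windows ([equidistributing_windows]).
    Weight k by a Fejer kernel at a(k) - d.  The weights concentrate on the k for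
    which a(k) lies slightly above an integer, where [a(k)] may be replaced by
    a(k); expanding the kernel shows that the weighted mean of
    cos (2 pi t [a(k)]) tends to something nearly nonnegative, for each t in
    [0, 1] separately.  The convergence is not uniform in t, because it depends
    on how well multiples of t are approximated by rationals.  A Mazur type
    argument repairs this: some convex combination of the polynomials attached
    to different windows is uniformly almost nonnegative
    ([uniform_of_pointwise]).

    It remains to find the windows.  Derivatives of a are monotone because they
    lie in a Hardy field, and some derivative tends to 0 by polynomial growth.
    Integrating back step by step, a = P + b with P a real polynomial, where
    either b tends to 0, or, for some e, P has only terms of degree > e,
    the e-th derivative of b is unbounded and the next one tends to 0
    ([split_leading_polynomial]).  The windows are i-indexed families of
    intervals of length (N + 1)!, so far out that the e-th derivative of b is
    almost constant on each; by the intermediate value theorem these constants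
    can be prescribed to form a fine grid ([sample_windows]).  Fix t <> 0.

    - If t c_k / (2 pi) is irrational for some coefficient c_k with k > 0, take k maximal
      and split each interval into residue classes modulo a common denominator q
      of the higher coefficients.  These become invisible modulo 2 pi, and the
      phase is almost a polynomial of degree k with irrational leading
      coefficient; k - 1 applications of van der Corput's inequality leave
      geometric sums ([avg_cos_irrational_coefficient]).  If b tends to 0 this
      case always occurs: otherwise P would be a constant plus a real multiple of
      an integer polynomial, against the hypothesis on a.

    - If all these numbers are rational, P disappears modulo 2 pi on residue
      classes.  Then e applications of van der Corput's inequality reduce the
      phase to a multiple of the e-th derivative of b, and averaging over the
      grid of its values gives cancellation ([avg_cos_rational_coefficients]). *)

Set Implicit Arguments.
Unset Strict Implicit.
Unset Printing Implicit Defensive.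

(** * Trigonometric sums *)

Lemma sinDpiz (R : realType) (x : R) (k : int) :
  `|sin (x + pi * k%:~R)| = `|sin x|.
Proof.
elim/int_ind: k x => [|n IH|n IH] x.
- by rewrite mulr0 addr0.
- by rewrite intS (addrC 1) intrD mulrDr mulr1 addrA sinDpi normrN IH.
- rewrite -(IH x) intS opprD (addrC (-1)) intrD mulrDr mulrN1 addrA.
  by rewrite -[in RHS](subrK pi (x + _)) sinDpi normrN.
Qed.

Lemma cosD2piz (R : realType) (x : R) (k : int) :
  cos (x + 2 * pi * k%:~R) = cos x.
Proof.
have per (y : R) : cos (y + 2 * pi) = cos y by rewrite mulr_natl cosD2pi.
elim/int_ind: k x => [|n IH|n IH] x.
- by rewrite mulr0 addr0.
- by rewrite intS (addrC 1) intrD mulrDr mulr1 addrA per IH.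
- rewrite -(IH x) intS opprD (addrC (-1)) intrD mulrDr mulrN1 addrA.
  by rewrite -[LHS]per; congr cos; ring.
Qed.

Lemma sinD2piz (R : realType) (x : R) (k : int) :
  sin (x + 2 * pi * k%:~R) = sin x.
Proof. by rewrite -!cosBpihalf addrAC cosD2piz. Qed.

Lemma sin_eq0_pi (R : realType) (x : R) : sin x = 0 -> exists k : int, x = pi * k%:~R.
Proof.
move=> sx; have p0 := pi_gt0 R.
exists (Num.floor (x / pi)).
have /andP[f1 f2] := floor_itv (x / pi).
move: f1 f2; rewrite ler_pdivlMr// ltr_pdivrMr// intrD mulrDl mul1r.
set k := Num.floor _ => f1 f2.
have := sinDpiz (x - pi * k%:~R) k; rewrite subrK sx normr0 => /esym/eqP.
rewrite normr_eq0 => /eqP s0.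
apply/eqP; rewrite -subr_eq0; apply/negPn/negP => nz.
suff : 0 < sin (x - pi * k%:~R) by rewrite s0 ltxx.
apply: sin_gt0_pi; rewrite lt_neqAle eq_sym nz /=; lra.
Qed.

(** Multiplying by 2 sin (x / 2) makes the sum telescope. *)
Lemma sum_cos_arith (R : realType) (x p : R) (m : nat) :
  2 * sin (x / 2) * \sum_(j < m) cos (j%:R * x + p) =
  sin (m%:R * x + p - x / 2) - sin (p - x / 2).
Proof.
elim: m => [|m IH]; first by rewrite big_ord0 mulr0 mul0r add0r subrr.
rewrite big_ord_recr /= mulrDr IH.
have -> : m.+1%:R * x + p - x / 2 = (m%:R * x + p) + x / 2 by rewrite -natr1; field.
by move: (m%:R * x + p) => y; rewrite (sinD y (x / 2)) (sinB y); ring.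
Qed.

Lemma sum_cos_arith_le (R : realType) (x p : R) (m : nat) :
  `|sin (x / 2)| * `|\sum_(j < m) cos (j%:R * x + p)| <= 1.
Proof.
have := congr1 Num.norm (sum_cos_arith x p m).
rewrite !normrM (@ger0_norm _ 2)// => E.
rewrite -(@ler_pM2l _ 2)// mulr1 mulrA E (le_trans (ler_normB _ _))//.
by rewrite [leRHS](_ : _ = 1 + 1) ?lerD ?sin_max//; lra.
Qed.

Lemma sum_sin_arith_le (R : realType) (x p : R) (m : nat) :
  `|sin (x / 2)| * `|\sum_(j < m) sin (j%:R * x + p)| <= 1.
Proof.
under eq_bigr do rewrite -cosBpihalf -addrA.
exact: sum_cos_arith_le.
Qed.

(** Orthogonality of the characters of Z / M, in real form. *)
Lemma sum_cos_roots (R : realType) (M : nat) (k : int) :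
  ~~ (M%:Z %| k)%Z ->
  \sum_(j < M) cos (j%:R * (2 * pi * k%:~R / M%:R)) = 0 :> R.
Proof.
move=> Mk; have [->|M0] := eqVneq M 0%N; first by rewrite big_ord0.
have MR : (M%:R : R) != 0 by rewrite pnatr_eq0.
have := sum_cos_arith (2 * pi * k%:~R / M%:R : R) 0 M.
under eq_bigr do rewrite addr0.
rewrite addr0 (_ : M%:R * _ - _ = 0 - 2 * pi * k%:~R / M%:R / 2 + 2 * pi * k%:~R); last first.
  by field.
rewrite sinD2piz subrr => /eqP; rewrite !mulf_eq0 pnatr_eq0 /= => /orP[|/eqP//].
move/eqP/sin_eq0_pi => [l].
rewrite (_ : _ / 2 = pi * (k%:~R / M%:R)); last by field.
move/(mulfI (lt0r_neq0 (pi_gt0 R))) => /(congr1 (fun z => z * M%:R)).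
rewrite divfK// -[M%:R]/((M%:Z)%:~R) -intrM => /intr_inj kE.
by case/negP: Mk; rewrite kE dvdz_mull.
Qed.

Lemma cos_lipschitz (R : realType) (x y : R) : `|cos x - cos y| <= `|x - y|.
Proof.
wlog xy : x y / x <= y.
  by move=> H; case/orP: (le_total x y) => /H //; rewrite distrC (distrC y).
have [z _ E] : exists2 z, z \in `[x, y]%R & cos y - cos x = - sin z * (y - x).
  apply: MVT_segment => //.
  by apply: continuous_subspaceT; exact: continuous_cos.
rewrite distrC (distrC x) E normrM normrN ler_piMl//; exact: sin_max.
Qed.

(** * Recurrence from almost nonnegative cosine polynomials *)

Definition cos_poly (R : realType) (ws : seq (R * int)) (t : R) : R :=
  \sum_(p <- ws) p.1 * cos (2 * pi * t * p.2%:~R).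

(** The left factor is |c^(x)|^2 for the exponential sum c^ of the sequence c;
    the sine part of the expansion cancels by the symmetry between j and k. *)
Lemma dft_square (R : realType) (N : nat) (c : nat -> R) (x s : R) :
  ((\sum_(j < N) c j * cos (x * j%:R)) ^+ 2 +
   (\sum_(j < N) c j * sin (x * j%:R)) ^+ 2) * cos (x * s) =
  \sum_(j < N) \sum_(k < N) c j * c k * cos (x * (k%:R - j%:R - s)).
Proof.
set A := \sum_(j < N) c j * cos _; set B := \sum_(j < N) c j * sin _.
transitivity ((A * A + B * B) * cos (x * s) + (A * B - B * A) * sin (x * s)).
  by ring.
rewrite /A /B !big_distrlr /= -sumrB -big_split /= !mulr_suml -big_split /=.
apply: eq_bigr => j _; rewrite -sumrB -big_split /= !mulr_suml -big_split /=.
apply: eq_bigr => k _.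
rewrite (_ : x * (_ - _) = (x * k%:R - x * j%:R) - x * s); last by ring.
by rewrite cosB cosB sinB; ring.
Qed.

(** Let E be the set with indicator c.  Summing dft_square over the frequencies
    x = 2 pi z / M counts the pairs of E whose difference is congruent to s modulo
    M.  As M = 2 N exceeds every |j - k - s|, this is the number of pairs with
    difference s, which is 0.  On the other hand the frequency z = 0 contributes
    |E|^2 \sum w, and by Parseval the others contribute at least - e M |E|. *)
Lemma sparse_of_cos_poly (R : realType) (ws : seq (R * int)) (N : nat) (c : nat -> R)
    (e : R) :
  (0 < N)%N -> (forall p, p \in ws -> (`|p.2| <= N)%N) ->
  1 / 2 <= \sum_(p <- ws) p.1 -> 0 <= e ->
  (forall t, 0 <= t <= 1 -> - e <= cos_poly ws t) ->
  (forall j, c j = 0 \/ c j = 1) ->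
  (forall p, p \in ws -> forall j k, (j < N)%N -> (k < N)%N ->
     c j = 1 -> c k = 1 -> k%:Z - j%:Z <> p.2) ->
  \sum_(j < N) c j <= 4 * e * N%:R.
Proof.
move=> N0 wsN W e0 lo c01 nod.
pose M := (2 * N)%N.
have MR : (0 : R) < M%:R by rewrite ltr0n muln_gt0.
pose x (z : nat) : R := 2 * pi * (z%:R / M%:R).
pose P z := (\sum_(j < N) c j * cos (x z * j%:R)) ^+ 2 +
   (\sum_(j < N) c j * sin (x z * j%:R)) ^+ 2.
have P0 z : 0 <= P z by rewrite addr_ge0// sqr_ge0.
have cc j : c j * c j = c j by case: (c01 j) => ->; rewrite ?mul0r ?mul1r.
set S := \sum_(j < N) c j.
have c0 j : 0 <= c j by case: (c01 j) => ->.
have S0 : 0 <= S by apply: sumr_ge0 => j _.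
have orth (s : int) (j k : 'I_N) : (`|s| <= N)%N ->
    k%:Z - j%:Z <> s ->
    \sum_(z < M) cos (x z * (k%:R - j%:R - s%:~R)) = 0 :> R.
  move=> sN kjs.
  have := @sum_cos_roots R M (k%:Z - j%:Z - s); under eq_bigr => z _.
    rewrite (_ : _ * _ = x z * (k%:R - j%:R - s%:~R)); last first.
      by rewrite !intrB /x; field; rewrite lt0r_neq0.
    over.
  apply; apply/negP => /dvdzP [q qE].
  have jN := ltn_ord j; have kN := ltn_ord k.
  have q0 : q = 0 by move: qE; rewrite /M; nia.
  by apply: kjs; move: qE; rewrite q0 mul0r; lia.
have tot : \sum_(z < M) P z * cos_poly ws (z%:R / M%:R) = 0.
  under eq_bigr do rewrite /cos_poly mulr_sumr.
  rewrite exchange_big /= big_seq big1// => p pws.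
  under eq_bigr => z _.
    rewrite mulrCA /P dft_square mulr_sumr.
    over.
  rewrite exchange_big big1//= => j _.
  under eq_bigr do rewrite mulr_sumr.
  rewrite exchange_big big1//= => k _.
  rewrite -mulr_sumr -mulr_sumr.
  case: (c01 j) => [->|cj]; first by rewrite !mul0r mulr0.
  case: (c01 k) => [->|ck]; first by rewrite !(mulr0,mul0r).
  by rewrite orth ?mulr0//; [exact: wsN|exact: nod].
have pars : \sum_(z < M) P z = M%:R * S.
  have E z : P z = \sum_(j < N) \sum_(k < N) c j * c k * cos (x z * (k%:R - j%:R - 0)).
    by rewrite -dft_square mulr0 cos0 mulr1.
  under eq_bigr do rewrite E.
  rewrite exchange_big /= mulr_sumr; apply: eq_bigr => j _.
  rewrite exchange_big /= (bigD1 j)//= [X in _ + X]big1 ?addr0.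
    under eq_bigr do rewrite subrr subr0 mulr0 cos0 mulr1 cc.
    by rewrite sumr_const card_ord mulr_natl.
  move=> k kj; rewrite -mulr_sumr (orth 0) ?mulr0// => /eqP.
  by rewrite subr_eq0 eqz_nat => /eqP kj'; case/eqP: kj; exact: val_inj.
have z0 : (0 < M)%N by rewrite muln_gt0.
have main : S ^+ 2 * (1 / 2) <= e * (M%:R * S).
  have P00 : P 0%N = S ^+ 2.
    rewrite /P /x mul0r mulr0.
    under eq_bigr do rewrite mul0r cos0 mulr1.
    under [X in _ + X ^+ 2]eq_bigr do rewrite mul0r sin0 mulr0.
    by rewrite [X in _ + X ^+ 2]big1// expr0n addr0.
  have low (z : 'I_M) : - e * P z <= P z * cos_poly ws (z%:R / M%:R).
    rewrite mulrC ler_wpM2l ?P0// lo// divr_ge0//= ler_pdivrMr// mul1r.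
    by rewrite ler_nat ltnW.
  pose o := Ordinal z0.
  move: tot; rewrite (bigD1 o)//= P00 mul0r => tot.
  have t0 : cos_poly ws 0 = \sum_(p <- ws) p.1.
    by apply: eq_bigr => p _; rewrite mulr0 mul0r cos0 mulr1.
  move: tot; rewrite t0 => tot.
  rewrite -pars (bigD1 o)//= P00 mulrDr mulr_sumr.
  have : \sum_(z < M | z != o) - e * P z <=
      \sum_(z < M | z != o) P z * cos_poly ws (z%:R / M%:R) by exact: ler_sum.
  under eq_bigr do rewrite mulNr.
  rewrite sumrN.
  have := sqr_ge0 S; nra.
have [->|Sn] := eqVneq S 0; first by rewrite !mulr_ge0.
have Sp : 0 < S by rewrite lt_neqAle eq_sym Sn.
have : S * (1 / 2) <= e * M%:R by nra.
rewrite /M natrM; lra.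
Qed.

Lemma iter_intB (X : Type) (T Ti : X -> X) (s : int) (j k : nat) x :
  cancel T Ti -> k%:Z - j%:Z = s -> iter_int T Ti s (iter j T x) = iter k T x.
Proof.
move=> TK; case: s => n E /=.
  by rewrite -iterD; congr iter; lia.
have -> : j = (n.+1 + k)%N by lia.
rewrite iterD; move: (iter k T x) => y.
have can m : iter m Ti (iter m T y) = y.
  by elim: m => [//|m IH]; rewrite iterSr iterS TK.
exact: (can n.+1).
Qed.

Lemma measurable_iter d (X : measurableType d) (T : X -> X) n :
  measurable_fun setT T -> measurable_fun setT (iter n T).
Proof.
move=> mT; elim: n => [|n IH]; first exact: measurable_id.
exact: (measurableT_comp mT IH).
Qed.

Lemma measurable_iter_int d (X : measurableType d) (T Ti : X -> X) (s : int) :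
  measurable_fun setT T -> measurable_fun setT Ti ->
  measurable_fun setT (iter_int T Ti s).
Proof. by move=> mT mTi; case: s => n; exact: measurable_iter. Qed.

(** The mean number of visits to A before time N is N mu(A).  If no s returned A
    to itself with positive measure, almost every point would have a set of visit
    times free of differences s, hence fewer than 4 e N visits. *)
Lemma recurrence_of_cos_poly (R : realType) (d : measure_display)
    (X : measurableType d) (mu : probability X R) (T Ti : X -> X) (A : set X)
    (ws : seq (R * int)) (e : R) :
  is_system mu T Ti -> measurable A ->
  1 / 2 <= \sum_(p <- ws) p.1 -> 0 <= e ->
  (forall t, 0 <= t <= 1 -> - e <= cos_poly ws t) ->
  ((4 * e)%:E < mu A)%E ->
  exists2 p, p \in ws & (0 < mu (A `&` iter_int T Ti p.2 @^-1` A))%E.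
Proof.
move=> [_ TK TiK mT mTi pres] mA W e0 lo muA; apply: contrapT => norec.
pose N := (\max_(p <- ws) `|p.2|%N).+1.
have wsN p : p \in ws -> (`|p.2| <= N)%N.
  by move=> pw; rewrite leqW// (@leq_bigmax_seq _ _ xpredT (fun p => `|p.2|%N)).
have mI n B : measurable B -> measurable (iter n T @^-1` B).
  by move=> mB; rewrite -[X in measurable X]setTI; exact: measurable_iter.
have muI n B : measurable B -> mu (iter n T @^-1` B) = mu B.
  move=> mB; elim: n => [//|n IH]; rewrite -IH -[RHS]pres; last exact: mI.
  by congr (mu _); apply/seteqP; split=> x /=; rewrite -iterS iterSr.
pose c x j : R := \1_(iter j T @^-1` A) x.
have null (i j : nat) : {ae mu, forall x, (i < size ws)%N ->
    ~ (A `&` iter_int T Ti (nth (0, 0) ws i).2 @^-1` A) (iter j T x)}.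
  have [iw|iw] := ltnP i (size ws); last by apply: aeW => x.
  set p := nth _ _ _; have pw : p \in ws by rewrite mem_nth.
  have mB : measurable (A `&` iter_int T Ti p.2 @^-1` A).
    apply: measurableI => //; rewrite -[X in measurable X]setTI.
    exact: measurable_iter_int.
  exists (iter j T @^-1` (A `&` iter_int T Ti p.2 @^-1` A)); split.
  - exact: mI.
  - apply/eqP; rewrite muI// eq_le measure_ge0 andbT leNgt.
    by apply/negP => H; apply: norec; exists p.
  - by move=> x /= /not_implyP[_ /contrapT].
have ae : {ae mu, forall x, (setT : set X) x ->
    (\sum_(j < N) (c x j)%:E <= (4 * e * N%:R)%:E)%E}.
  have := ae_foralln (fun i => ae_foralln (null i)).
  apply: filterS => x Hx _.
  rewrite sumEFin lee_fin; apply: (sparse_of_cos_poly (ws := ws)) => //.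
  - move=> j; rewrite /c indicE; case: (_ \in _); [by right|by left].
  - move=> p pw j k jN kN cj ck kj.
    have := Hx (index p ws) j; rewrite index_mem => /(_ pw); rewrite nth_index//; apply.
    have inA l : c x l = 1 -> A (iter l T x).
      rewrite /c indicE; case: (boolP (x \in _)) => [/set_mem//|_ /esym/eqP].
      by rewrite oner_eq0.
    by split=> /=; [exact: inA|rewrite (iter_intB _ TK kj); exact: inA].
have mc j : measurable_fun setT (fun x => (c x j)%:E).
  apply/measurable_EFinP; rewrite /c; apply: measurable_indic; exact: mI.
have c0 j (x : X) : (0 <= (c x j)%:E)%E by rewrite lee_fin /c indicE.
have : (\int[mu]_x (\sum_(j < N) (c x j)%:E) <=
    \int[mu]_x (cst (4 * e * N%:R)%:E) x)%E.
  apply: ae_ge0_le_integral => //.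
  - by move=> x _; exact: sume_ge0.
  - exact: emeasurable_sum.
  - by move=> x _; rewrite /= lee_fin !mulr_ge0.
rewrite integral_cst//.
have -> : ((4 * e * N%:R)%:E * mu setT)%E = (4 * e * N%:R)%:E.
  by have -> : mu setT = 1%E by [exact: probability_setT]; rewrite mule1.
rewrite ge0_integral_sum//.
rewrite (eq_bigr (fun=> mu A)); last first.
  move=> j _; rewrite integral_indic//; last exact: mI.
  by rewrite setIT; exact: muI.
have fA : mu A \is a fin_num by exact: fin_num_measure.
move: muA; rewrite -(fineK fA) lte_fin => muA.
rewrite sumEFin lee_fin sumr_const card_ord -(mulr_natr (fine (mu A))) leNgt.
by rewrite ltr_pM2r ?ltr0n// muA.
Qed.

(** * From pointwise to uniform bounds by convex combinations *)

(** The members of C n play the role of convex combinations of the terms of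
    index at least n of a sequence of functions. *)
Record convex_chain (T : Type) (R : realType) (C : nat -> set (T -> R)) : Prop :=
  ConvexChain {
  chain_convex : forall n f g t, C n f -> C n g -> 0 <= t <= 1 ->
    C n (fun x => t * f x + (1 - t) * g x);
  chain_decr : forall n, C n.+1 `<=` C n;
  chain_nonempty : forall n, C n !=set0
}.

Lemma chain_decrD (T : Type) (R : realType) (C : nat -> set (T -> R)) m n :
  convex_chain C -> C (m + n)%N `<=` C n.
Proof.
move=> cC; elim: m => [//|m IH] f; rewrite addSn => /(chain_decr cC); exact: IH.
Qed.

Lemma chain_shift (T : Type) (R : realType) (C : nat -> set (T -> R)) m :
  convex_chain C -> convex_chain (fun n => C (m + n)%N).
Proof.
move=> cC; split=> [n f g t|n f|n].
- exact: chain_convex.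
- by rewrite addnS; exact: chain_decr.
- exact: chain_nonempty.
Qed.

Definition attains_level (T : Type) (R : realType) (C : set (T -> R)) (Y : set T) (v : R) :=
  forall f, C f -> exists2 x, Y x & v <= f x.

(** Otherwise, given f, the chain could be refined to one whose members are all
    below d wherever f is at least d.  Iterating, one gets functions f_0, f_1, ...
    such that at each point at most one f_i reaches the level d; their mean over
    many indices is then below v everywhere on Y, although it belongs to C 0. *)
Lemma attains_level_refine (T : Type) (R : realType) (C : nat -> set (T -> R))
    (Y : set T) (B v d : R) :
  convex_chain C -> 0 <= B -> (forall f, C 0%N f -> forall x, Y x -> f x <= B) ->
  attains_level (C 0%N) Y v -> 0 <= d < v ->
  exists f C', [/\ C 0%N f, convex_chain C', forall n, C' n `<=` C n &
    attains_level (C' 0%N) (Y `&` [set x | d <= f x]) d].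
Proof.
move=> cC B0 CB rC /andP[d0 dv]; apply: contrapT => noref.
have small f C' : C 0%N f -> convex_chain C' -> (forall n, C' n `<=` C n) ->
    exists C'', [/\ convex_chain C'', forall n, C'' n `<=` C' n &
      forall g, C'' 0%N g -> forall x, Y x -> d <= f x -> g x < d].
  move=> Cf cC' sC'.
  exists (fun n => C' n `&` [set g | forall x, Y x -> d <= f x -> g x < d]).
  split; [|by move=> n g []|by move=> g []].
  split=> [n g h t [Cg gd] [Ch hd] /andP[t0 t1]|n g [Cg gd]|n].
  - split; first by apply: chain_convex => //; rewrite t0.
    move=> x Yx fx /=; have gx := gd x Yx fx; have hx := hd x Yx fx.
    have [t12|t12] := lerP t (1 / 2); nra.
  - by split=> //; apply: (chain_decr cC').
  - apply: contrapT => emp; apply: noref.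
    exists f, (fun k => C' (n + k)%N); split=> //.
    + exact: chain_shift.
    + by move=> k g /(chain_decrD cC')/sC'.
    + move=> g; rewrite addn0 => Cg; apply: contrapT => nox; apply: emp.
      exists g; split=> // x Yx fx; rewrite ltNge; apply/negP => gx.
      by apply: nox; exists x.
have avg (J : nat) : exists C' S, [/\ convex_chain C', forall n, C' n `<=` C n,
    C 0%N (fun x => S x / J.+1%:R) &
    forall x, Y x -> S x <= J.+1%:R * d \/
      (S x <= J.+1%:R * d + B /\ forall g, C' 0%N g -> g x < d)].
  elim: J => [|J [C1 [S [cC1 sC1 CS HS]]]].
    have [f Cf] := chain_nonempty cC 0.
    have [C1 [cC1 sC1 H1]] := small f C Cf cC (fun n => @subset_refl _ _).
    exists C1, f; split=> //.
      by under eq_fun do rewrite divr1.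
    move=> x Yx; case: (ltP (f x) d) => fx; [left|right]; rewrite mul1r.
      exact: ltW.
    split; last by move=> g Cg; exact: H1 Cg x Yx fx.
    by have := CB f Cf x Yx; lra.
  have [f Cf] := chain_nonempty cC1 0.
  have C0f : C 0%N f by exact: sC1.
  have [C2 [cC2 sC2 H2]] := small f C1 C0f cC1 sC1.
  exists C2, (fun x => S x + f x); split=> //.
  - by move=> n g /sC2/sC1.
  - have J0 : (J.+1%:R : R) != 0 by rewrite pnatr_eq0.
    have J1 : (J.+2%:R : R) != 0 by rewrite pnatr_eq0.
    rewrite (_ : (fun _ => _) =
      (fun x => (J.+1%:R / J.+2%:R) * (S x / J.+1%:R) + (1 - J.+1%:R / J.+2%:R) * f x)).
      apply: (chain_convex cC) => //.
      by rewrite divr_ge0 //= ler_pdivrMr ?ltr0n// mul1r ler_nat.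
    apply/funext => x.
    rewrite -[J.+2%:R]natr1 in J1 *; move: (J.+1%:R) J0 J1 => j j0 j1.
    by field; rewrite j0 j1.
  - move=> x Yx; rewrite -[J.+2%:R]natr1 mulrDl mul1r.
    have fB := CB f C0f x Yx.
    case: (HS x Yx) => [S1|[S1 S2]].
      case: (ltP (f x) d) => fx; [left|right]; first by lra.
      split; first by lra.
      by move=> g Cg; exact: H2 Cg x Yx fx.
    right; split; first by have := S2 f Cf; lra.
    by move=> g Cg; exact: S2 (sC2 _ _ Cg).
(* B / (J + 1) is the cost of the one index where a function may reach d. *)
pose J := Num.truncn (B / (v - d)).
have [C' [S [_ _ CS HS]]] := avg J.
have [x Yx vx] := rC _ CS.
have vd : 0 < v - d by rewrite subr_gt0.
have BJ : B / (v - d) < J.+1%:R by exact: truncnS_gt.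
have J0 : (0 : R) < J.+1%:R by rewrite ltr0n.
move: BJ vx; rewrite ltr_pdivrMr// ler_pdivlMr// => BJ vx.
by case: (HS x Yx) => [|[+ _]]; nra.
Qed.

(** If every member of C 0 reached the level e' on K, repeated use of
    attains_level_refine would give functions f_k in C k and nested nonempty sets
    on which f_0, ..., f_k exceed the midpoint m of e and e'.  By compactness all f_k
    are at least m at some common point, where the chain is eventually at most e. *)
Lemma uniform_of_pointwise (T : topologicalType) (R : realType)
    (C : nat -> set (T -> R)) (K : set T) (B e e' : R) :
  convex_chain C -> compact K -> 0 <= B ->
  (forall f, C 0%N f -> continuous f) ->
  (forall f, C 0%N f -> forall x, K x -> f x <= B) ->
  (forall x, K x -> exists n, forall f, C n f -> f x <= e) ->
  0 <= e < e' ->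
  exists2 f, C 0%N f & forall x, K x -> f x < e'.
Proof.
move=> cC cK B0 cont CB ptw /andP[e0 ee']; apply: contrapT => nof.
pose m := (e + e') / 2.
(* Levels decreasing from e', but staying above m. *)
pose v k : R := m + (e' - m) / k.+1%:R.
have em : e < m by rewrite /m; lra.
have me' : m < e' by rewrite /m; lra.
have vm k : m < v k by rewrite /v ltrDl divr_gt0 ?ltr0n// subr_gt0.
have vS k : v k.+1 < v k.
  rewrite /v ltrD2l ltr_pM2l ?subr_gt0// ltf_pV2 ?posrE ?ltr0n//.
  by rewrite ltr_nat.
pose inv (s : nat * (nat -> set (T -> R)) * set T) :=
  [/\ convex_chain s.1.2, forall n, s.1.2 n `<=` C (s.1.1 + n)%N,
      s.2 `<=` K & attains_level (s.1.2 0%N) s.2 (v s.1.1)].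
pose st := {s | inv s}.
pose nxt (s s' : st) := (sval s').1.1 = (sval s).1.1.+1 /\
  exists2 f, C (sval s).1.1 f &
    (sval s').2 `<=` (sval s).2 `&` [set x | m <= f x].
have i0 : inv (0%N, C, K).
  split=> //= [|f Cf]; first by move=> n.
  apply: contrapT => H; apply: nof; exists f => // x Kx.
  rewrite ltNge; apply/negP => H'; apply: H; exists x => //.
  by rewrite /v divr1; lra.
(* The chain is shifted by one at each step, so that the k-th function comes
   from C k. *)
have step (s : st) : {s' | nxt s s'}.
  apply: cid; case: s => [[[k D] Y] [/= cD sD sY rD]].
  have cD1 := chain_shift 1 cD.
  have D10 : D (1 + 0)%N `<=` D 0%N by exact: chain_decr.
  have [|||f [D' [Df cD' sD' rD']]] :=
    @attains_level_refine _ _ (fun n => D (1 + n)%N) Y B (v k) (v k.+1) cD1 B0 _ _ _.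
  - move=> f /D10/sD Cf x Yx; apply: (CB f) => //; last exact: sY.
    by move: Cf; rewrite addn0 -{1}[k]addn0 => /(chain_decrD cC).
  - by move=> f /D10; exact: rD.
  - by rewrite vS andbT (le_trans e0)// ltW// (lt_trans em).
  have inv' : inv (k.+1, D', Y `&` [set x | v k.+1 <= f x]).
    split=> //=; last by move=> x [/sY].
    by move=> n g /sD'/sD; rewrite addnA addn1.
  exists (exist _ _ inv'); split=> //=; exists f.
    by move/D10: Df => /sD; rewrite addn0.
  move=> x [Yx /= fx]; split=> //=.
  by rewrite (le_trans _ fx)// ltW.
have [s [s0 sS]] := dependent_choice step (exist _ _ i0).
have sk k : (sval (s k)).1.1 = k.
  by elim: k => [|k IH]; [rewrite s0|rewrite (sS k).1 IH].
pose Y k := (sval (s k)).2.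
have YK k : Y k `<=` K by case: (svalP (s k)).
have Ydec k : Y k.+1 `<=` Y k by case: (sS k) => _ [f _ sub] x /sub[].
have YD j k : Y (j + k)%N `<=` Y k.
  elim: j => [//|j IH] x; rewrite addSn => /Ydec; exact: IH.
have Yne k : Y k !=set0.
  case: (svalP (s k)) => cD _ _ rD; have [f Df] := chain_nonempty cD 0.
  by have [x Yx _] := rD f Df; exists x.
pose x k := sval (cid (Yne k)).
have xY k : Y k (x k) by exact: (svalP (cid (Yne k))).
have FK : (x @ \oo) K by exists 0%N => // k _; exact: YK (xY k).
have [p [Kp clp]] := cK (x @ \oo) _ FK.
have [n Hn] := ptw p Kp.
have [f Cf Yf] := (sS n).2.
rewrite sk in Cf.
have fp := Hn f Cf.
have fc : continuous f.
  by apply: cont; move: Cf; rewrite -[n]addn0 => /(chain_decrD cC).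
have nb : nbhs p [set y | f y < m].
  have := fc p; move/cvgr_lt; apply; exact: le_lt_trans em.
have Fx : (x @ \oo) [set y | m <= f y].
  exists n.+1 => // k /= kn.
  have : Y n.+1 (x k) by apply: (YD (k - n.+1)%N); rewrite subnK.
  by move/Yf => [].
have [y [/= y1 y2]] := clp _ _ Fx nb.
by move: y2; rewrite ltNge y1.
Qed.

(** * Averages over windows and van der Corput's inequality *)

Lemma near_cvg (R : realType) (f g : nat -> R) (l : R) :
  (\forall N \near \oo, f N = g N) -> f N @[N --> \oo] --> l -> g N @[N --> \oo] --> l.
Proof. by move=> fg; apply: cvg_trans; exact: near_eq_cvg. Qed.

Definition avg (R : realType) (J L : nat) (u : nat -> nat -> R) : R :=
  (\sum_(i < J) \sum_(h < L) u i h) / (J * L)%:R.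

Lemma eq_avg (R : realType) (J L : nat) (u v : nat -> nat -> R) :
  (forall i h, (i < J)%N -> (h < L)%N -> u i h = v i h) -> avg J L u = avg J L v.
Proof.
move=> E; rewrite /avg; congr (_ / _); apply: eq_bigr => i _.
by apply: eq_bigr => h _; exact: E.
Qed.

Lemma avgD (R : realType) (J L : nat) (u v : nat -> nat -> R) :
  avg J L (fun i h => u i h + v i h) = avg J L u + avg J L v.
Proof.
rewrite /avg -mulrDl -big_split /=; congr (_ / _).
by apply: eq_bigr => i _; rewrite big_split.
Qed.

Lemma avgZ (R : realType) (J L : nat) (c : R) (u : nat -> nat -> R) :
  avg J L (fun i h => c * u i h) = c * avg J L u.
Proof.
rewrite /avg mulrA mulr_sumr; congr (_ / _).
by apply: eq_bigr => i _; rewrite mulr_sumr.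
Qed.

Lemma avgN (R : realType) (J L : nat) (u : nat -> nat -> R) :
  avg J L (fun i h => - u i h) = - avg J L u.
Proof.
rewrite -mulN1r -avgZ; apply: eq_avg => i h _ _; by rewrite mulN1r.
Qed.

Lemma avg_sum (R : realType) (J L H : nat) (u : nat -> nat -> nat -> R) :
  avg J L (fun i h => \sum_(r < H) u r i h) = \sum_(r < H) avg J L (u r).
Proof.
rewrite /avg -mulr_suml; congr (_ / _); rewrite [RHS]exchange_big /=.
by apply: eq_bigr => i _; rewrite exchange_big.
Qed.

Lemma avg_cst (R : realType) (J L : nat) (c : R) :
  (0 < J)%N -> (0 < L)%N -> avg J L (fun _ _ => c) = c.
Proof.
move=> J0 L0; rewrite /avg.
under eq_bigr do rewrite sumr_const card_ord.
rewrite sumr_const card_ord -mulrnA -(mulr_natr c) mulnC mulfK//.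
by rewrite pnatr_eq0 -lt0n muln_gt0 J0.
Qed.

Lemma ler_avg (R : realType) (J L : nat) (u v : nat -> nat -> R) :
  (forall i h, (i < J)%N -> (h < L)%N -> u i h <= v i h) -> avg J L u <= avg J L v.
Proof.
move=> uv; rewrite /avg ler_wpM2r ?invr_ge0// ler_sum// => i _.
by rewrite ler_sum// => h _; exact: uv.
Qed.

Lemma avg_norm_le (R : realType) (J L : nat) (u : nat -> nat -> R) (e : R) :
  (0 < J)%N -> (0 < L)%N ->
  (forall i h, (i < J)%N -> (h < L)%N -> `|u i h| <= e) -> `|avg J L u| <= e.
Proof.
move=> J0 L0 ue; rewrite ler_norml -{1}(@avg_cst R J L (- e))//.
rewrite -{2}(@avg_cst R J L e)//; apply/andP; split; apply: ler_avg => i h iJ hL;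
  by have := ue i h iJ hL; rewrite ler_norml => /andP[].
Qed.

Lemma avg_sqr_le (R : realType) (J L : nat) (u : nat -> nat -> R) :
  (0 < J)%N -> (0 < L)%N -> avg J L u ^+ 2 <= avg J L (fun i h => u i h ^+ 2).
Proof.
move=> J0 L0; set m := avg J L u.
have : avg J L (fun _ _ => 0) <= avg J L (fun i h => u i h ^+ 2 + ((- (2 * m)) * u i h + m ^+ 2)).
  apply: ler_avg => i h _ _.
  by rewrite (_ : _ + _ = (u i h - m) ^+ 2) ?sqr_ge0//; ring.
rewrite avg_cst// avgD avgD avgZ avg_cst// -/m; lra.
Qed.

Lemma avg_shift (R : realType) (J L r : nat) (u : nat -> nat -> R) :
  (0 < J)%N -> (0 < L)%N -> (forall i h, `|u i h| <= 1) ->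
  `|avg J L (fun i h => u i (h + r)%N) - avg J L u| <= 2 * r%:R / L%:R.
Proof.
move=> J0 L0 u1; have LR : (0 : R) < L%:R by rewrite ltr0n.
have JR : (0 : R) < J%:R by rewrite ltr0n.
have one i : `|\sum_(h < L) u i (h + r)%N - \sum_(h < L) u i h| <= 2 * r%:R.
  elim: r => [|r IH].
    by under eq_bigr do rewrite addn0; rewrite subrr normr0 mulr0.
  have tel : \sum_(h < L) u i (h + r.+1)%N - \sum_(h < L) u i (h + r)%N =
      u i (L + r)%N - u i r.
    rewrite -sumrB.
    rewrite -(big_mkord xpredT (fun h => u i (h + r.+1)%N - u i (h + r)%N)).
    under eq_bigr do rewrite addnS -addSn.
    by rewrite telescope_sumr.
  have t2 : `|u i (L + r)%N - u i r| <= 2.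
    have := ler_normB (u i (L + r)%N) (u i r).
    by have := u1 i (L + r)%N; have := u1 i r; lra.
  move: tel IH t2; set x := \sum_(h < L) u i (h + r.+1)%N.
  set y := \sum_(h < L) u i (h + r)%N; set z := \sum_(h < L) u i h => <- IH t2.
  have := ler_normD (x - y) (y - z); rewrite addrA subrK.
  by rewrite -[r.+1%:R]natr1; lra.
rewrite /avg -mulrBl -sumrB normrM normfV normr_nat.
rewrite natrM invfM mulrA ler_pM2r ?invr_gt0// ler_pdivrMr//.
rewrite (le_trans (ler_norm_sum _ _ _))//.
apply: (@le_trans _ _ (\sum_(i < J) 2 * r%:R)).
  by apply: ler_sum => i _; exact: one.
by rewrite sumr_const card_ord -(mulr_natr (2 * r%:R)).
Qed.

Lemma cvg_avg_shift (R : realType) (J L : nat -> nat) (r : nat)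
    (u : nat -> nat -> nat -> R) (l : R) :
  (forall N, (0 < J N)%N) -> (forall N, (0 < L N)%N) ->
  (L N)%:R @[N --> \oo] --> +oo_R -> (forall N i h, `|u N i h| <= 1) ->
  avg (J N) (L N) (u N) @[N --> \oo] --> l ->
  avg (J N) (L N) (fun i h => u N i (h + r)%N) @[N --> \oo] --> l.
Proof.
move=> J0 L0 Loo u1 ul.
pose D N := avg (J N) (L N) (fun i h => u N i (h + r)%N) - avg (J N) (L N) (u N).
have D0 : D N @[N --> \oo] --> 0.
  apply/cvgr0Pnorm_le => e e0; near=> N.
  rewrite (le_trans (avg_shift r (J0 N) (L0 N) (u1 N)))//.
  rewrite ler_pdivrMr ?ltr0n// (mulrC e) -ler_pdivrMr//.
  by near: N; by move/cvgryPge: Loo; apply.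
have H1 : D N + avg (J N) (L N) (u N) @[N --> \oo] --> 0 + l by exact: cvgD.
rewrite add0r in H1; apply: (near_cvg _ H1).
by near=> N; rewrite /= /D subrK.
Unshelve. all: by end_near.
Qed.

(** Replace cos (f h) by its mean over H consecutive shifts, which changes the
    average by a negligible amount, and apply the Cauchy-Schwarz inequality.  The
    square of the short mean, completed by the corresponding sine term, is the mean
    over pairs (r, s) of cos (f (h + r) - f (h + s)); the pairs r <> s vanish in the
    limit and the diagonal contributes 1 / H. *)
Lemma van_der_corput (R : realType) (J L : nat -> nat) (f : nat -> nat -> nat -> R) :
  (forall N, (0 < J N)%N) -> (forall N, (0 < L N)%N) ->
  (L N)%:R @[N --> \oo] --> +oo_R ->
  (forall r, (0 < r)%N ->
    avg (J N) (L N) (fun i h => cos (f N i (h + r)%N - f N i h)) @[N --> \oo] --> 0) ->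
  avg (J N) (L N) (fun i h => cos (f N i h)) @[N --> \oo] --> 0.
Proof.
move=> J0 L0 Loo diff; apply/cvgr0Pnorm_le => e e0.
(* So that 2 / H <= (e / 2)^2. *)
pose H := (Num.truncn (8 / e ^+ 2)).+1.
have H0 : (0 : R) < H%:R by rewrite ltr0n.
have He : 8 <= e ^+ 2 * H%:R.
  rewrite mulrC -ler_pdivrMr ?exprn_gt0//.
  by rewrite ltW//; exact: truncnS_gt.
pose D N (r s : nat) := avg (J N) (L N) (fun i h => cos (f N i (h + r)%N - f N i (h + s)%N)).
have Dlt (r s : nat) : (s < r)%N -> D N r s @[N --> \oo] --> 0.
  move=> sr; have r0 : (0 < r - s)%N by rewrite subn_gt0.
  have := @cvg_avg_shift R J L s (fun N i h => cos (f N i (h + (r - s))%N - f N i h)) 0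
    J0 L0 Loo (fun N i h => cos_max _) (diff _ r0).
  rewrite /D => H1; apply: (near_cvg _ H1); near=> N => /=.
  by apply: eq_avg => i h _ _; rewrite -addnA subnKC// ltnW.
have Dcv (r s : 'I_H) : D N r s @[N --> \oo] --> ((r == s)%:R : R).
  have [rs|sr|rs] := ltngtP r s.
  - rewrite (_ : (r == s) = false); last first.
      by apply/negbTE; rewrite -(inj_eq val_inj) ltn_eqF.
    have := Dlt _ _ rs => H1; apply: (near_cvg _ H1); near=> N => /=.
    by apply: eq_avg => i h _ _; rewrite -cosN opprB.
  - rewrite (_ : (r == s) = false); last first.
      by apply/negbTE; rewrite -(inj_eq val_inj) gtn_eqF.
    exact: Dlt.
  - rewrite (_ : (r == s) = true); last by apply/eqP; exact: val_inj.
    apply: cvg_near_cst; near=> N; rewrite /D rs.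
    under eq_avg do rewrite subrr cos0.
    by rewrite avg_cst.
pose V N := (\sum_(r < H) \sum_(s < H) D N r s) / H%:R ^+ 2.
have Vcv : V N @[N --> \oo] --> (H%:R^-1 : R).
  have -> : H%:R^-1 = (\sum_(r < H) \sum_(s < H) (r == s)%:R) / H%:R ^+ 2 :> R.
    under eq_bigr => r _.
      rewrite (bigD1 r)//= eqxx big1 ?addr0; last first.
        by move=> s /negbTE; rewrite eq_sym => ->.
      over.
    by rewrite sumr_const card_ord expr2 invfM mulrA mulfV ?mul1r ?lt0r_neq0.
  apply: cvgMl; apply: cvg_big => [|r _]; first exact: add_continuous.
  by apply: cvg_big => [|s _]; first exact: add_continuous.
near=> N.
pose g i h := (\sum_(r < H) cos (f N i (h + r)%N)) / H%:R.
have gE : avg (J N) (L N) g = (\sum_(r < H) avg (J N) (L N) (fun i h => cos (f N i (h + r)%N))) / H%:R.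
  rewrite -(avg_sum _ _ H (fun r i h => cos (f N i (h + r)%N))) mulrC -avgZ.
  by apply: eq_avg => i h _ _; rewrite mulrC.
have close : `|avg (J N) (L N) (fun i h => cos (f N i h)) - avg (J N) (L N) g| <= e / 2.
  have csum (c : R) : c * H%:R = \sum_(r < H) c by rewrite sumr_const card_ord mulr_natr.
  rewrite gE -(mulfK (lt0r_neq0 H0) (avg _ _ _)) -mulrBl csum -sumrB.
  rewrite normrM normfV normr_nat ler_pdivrMr// (le_trans (ler_norm_sum _ _ _))//.
  rewrite csum ler_sum// => r _.
  rewrite distrC (le_trans (avg_shift r (J0 N) (L0 N) _))//.
    by move=> i h; exact: cos_max.
  have rH : (r%:R : R) <= H%:R by rewrite ler_nat ltnW.
  rewrite ler_pdivrMr ?ltr0n//.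
  have : 4 * H%:R / e <= (L N)%:R by near: N; by move/cvgryPge: Loo; apply.
  rewrite ler_pdivrMr//; nra.
have sq : avg (J N) (L N) g ^+ 2 <= V N.
  rewrite (le_trans (avg_sqr_le _ (J0 N) (L0 N)))//.
  have -> : V N = avg (J N) (L N) (fun i h => (H%:R ^+ 2)^-1 *
      \sum_(r < H) \sum_(s < H) cos (f N i (h + r)%N - f N i (h + s)%N)).
    rewrite avgZ mulrC; congr (_ * _).
    rewrite (avg_sum _ _ H (fun r i h =>
      \sum_(s < H) cos (f N i (h + r)%N - f N i (h + s)%N))).
    apply: eq_bigr => r _.
    by rewrite (avg_sum _ _ H (fun s i h => cos (f N i (h + r)%N - f N i (h + s)%N))).
  apply: ler_avg => i h _ _.
  rewrite /g expr_div_n [leLHS]mulrC ler_pM2l ?invr_gt0 ?exprn_gt0//.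
  set A := \sum_(r < H) cos (f N i (h + r)%N); pose B := \sum_(r < H) sin (f N i (h + r)%N).
  have -> : \sum_(i0 < H) \sum_(r < H) cos (f N i (h + i0)%N - f N i (h + r)%N) =
      A ^+ 2 + B ^+ 2.
    rewrite /A /B !expr2 !big_distrlr /= -big_split /=; apply: eq_bigr => r _.
    by rewrite -big_split /=; apply: eq_bigr => s _; rewrite cosB.
  by rewrite lerDl sqr_ge0.
have V2 : V N <= 2 / H%:R.
  near: N; apply: (cvgr_le _ Vcv).
  by rewrite ltr_pdivlMr// mulVf ?lt0r_neq0// ltr1n.
have g2 : `|avg (J N) (L N) g| <= e / 2.
  have : avg (J N) (L N) g ^+ 2 <= (e / 2) ^+ 2.
    by rewrite (le_trans sq)// (le_trans V2)// ler_pdivrMr//; lra.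
  by move: (avg _ _ g) => x xe; apply/ler_normlP; split; nra.
rewrite -(subrK (avg (J N) (L N) g) (avg _ _ _)) (le_trans (ler_normD _ _))//.
by lra.
Unshelve. all: by end_near.
Qed.

(** * Functions with almost constant d-th difference *)

(** The d-th difference of f stays within e of g on the first M integers: f behaves
    like a polynomial with leading coefficient g / d!.  Recursion on d makes every
    closure property an induction, with no Taylor expansion. *)
Fixpoint near_poly (R : realType) (d M : nat) (g e : R) (f : nat -> R) : Prop :=
  if d is d'.+1 then near_poly d' M g e (fun h => f h.+1 - f h)
  else forall h, (h < M)%N -> `|f h - g| <= e.

Lemma near_poly_mono (R : realType) d M M' (g e e' : R) f :
  (M' <= M)%N -> e <= e' -> near_poly d M g e f -> near_poly d M' g e' f.
Proof.
move=> MM ee; elim: d f => [|d IH] f /=; last exact: IH.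
by move=> Hf h hM; rewrite (le_trans (Hf h _))// (leq_trans hM).
Qed.

Lemma near_polyD (R : realType) d M (g1 g2 e1 e2 : R) f1 f2 :
  near_poly d M g1 e1 f1 -> near_poly d M g2 e2 f2 ->
  near_poly d M (g1 + g2) (e1 + e2) (fun h => f1 h + f2 h).
Proof.
elim: d f1 f2 => [|d IH] f1 f2 /= H1 H2.
  move=> h hM; rewrite opprD addrACA (le_trans (ler_normD _ _))//.
  by rewrite lerD ?H1 ?H2.
rewrite (_ : (fun h => _) = fun h => (f1 h.+1 - f1 h) + (f2 h.+1 - f2 h)); first exact: IH.
by apply/funext => h; rewrite opprD addrACA.
Qed.

Lemma near_polyZ (R : realType) d M (c g e : R) f :
  near_poly d M g e f -> near_poly d M (c * g) (`|c| * e) (fun h => c * f h).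
Proof.
elim: d f => [|d IH] f /= H.
  by move=> h hM; rewrite -mulrBr normrM ler_wpM2l// H.
by under eq_fun do rewrite -mulrBr; exact: IH.
Qed.

Lemma near_poly_shift (R : realType) d M r (g e : R) f :
  near_poly d (M + r) g e f -> near_poly d M g e (fun h => f (h + r)%N).
Proof.
elim: d f => [|d IH] f /= H.
  by move=> h hM; apply: H; rewrite ltn_add2r.
exact: (IH _ H).
Qed.

Lemma near_poly_cst (R : realType) d M (c : R) :
  near_poly d M (c *+ (d == 0%N)) 0 (fun=> c).
Proof.
case: d => [h hM|d] /=; first by rewrite mulr1n subrr normr0.
rewrite mulr0n; under eq_fun do rewrite subrr.
elim: d => [h hM|d IH] /=; first by rewrite subrr normr0.
by under eq_fun do rewrite subrr.
Qed.

Lemma near_poly_sum (R : realType) d M (I : Type) (s : seq I) (g e : I -> R) F :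
  (forall j, near_poly d M (g j) (e j) (F j)) ->
  near_poly d M (\sum_(j <- s) g j) (\sum_(j <- s) e j) (fun h => \sum_(j <- s) F j h).
Proof.
move=> H; elim: s => [|j s IH].
  rewrite !big_nil (_ : (fun h => _) = fun=> 0); last first.
    by apply/funext => h; rewrite big_nil.
  by have := near_poly_cst d M (0 : R); rewrite mul0rn.
rewrite !big_cons (_ : (fun h => _) = fun h => F j h + \sum_(j <- s) F j h).
  exact: near_polyD.
by apply/funext => h; rewrite big_cons.
Qed.

Lemma near_poly_sum_shift (R : realType) d M q r (g e : R) f :
  near_poly d (M + (q + r)) g e f ->
  near_poly d M (q%:R * g) (q%:R * e) (fun h => \sum_(j < q) f (h + (j + r))%N).
Proof.
elim: q => [|q IH] H.
  rewrite !mul0r (_ : (fun h => _) = fun=> 0); last first.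
    by apply/funext => h; rewrite big_ord0.
  by have := near_poly_cst d M (0 : R); rewrite mul0rn.
rewrite (_ : (fun h => _) =
    fun h => \sum_(j < q) f (h + (j + r))%N + f (h + (q + r))%N); last first.
  by apply/funext => h; rewrite big_ord_recr.
rewrite -natr1 !mulrDl !mul1r; apply: near_polyD.
  by apply: IH; apply: near_poly_mono H => //; rewrite leq_add2l leq_add2r.
by apply: near_poly_shift; apply: near_poly_mono H => //; rewrite leq_add2l leq_add2r.
Qed.

(** A difference with step r is a sum of r shifted unit differences. *)
Lemma near_poly_diff (R : realType) d M r (g e : R) f :
  near_poly d.+1 (M + r) g e f ->
  near_poly d M (r%:R * g) (r%:R * e) (fun h => f (h + r)%N - f h).
Proof.
move=> /= H; rewrite (_ : (fun h => _) =
    fun h => \sum_(j < r) (f (h + (j + 0)).+1%N - f (h + (j + 0))%N)); last first.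
  apply/funext => h; under eq_bigr do rewrite addn0.
  rewrite -(big_mkord xpredT (fun j => f (h + j).+1%N - f (h + j)%N)).
  under eq_bigr do rewrite -addnS.
  by rewrite telescope_sumr// addn0.
by have := @near_poly_sum_shift R d M r 0 g e (fun h => f h.+1 - f h); rewrite addn0; apply.
Qed.

(** Each unit difference along the progression q h + r is a sum of q shifted unit
    differences, which accounts for one factor q for each order of differencing. *)
Lemma near_poly_subst (R : realType) d M q r (g e : R) f : (0 < q)%N ->
  near_poly d (q * (M + d) + r) g e f ->
  near_poly d M (q%:R ^+ d * g) (q%:R ^+ d * e) (fun h => f (q * h + r)%N).
Proof.
move=> q0; elim: d M r f => [|d IH] M r f /= H.
  by move=> h hM; rewrite expr0 !mul1r; apply: H; rewrite addn0 ltn_add2r ltn_pmul2l.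
rewrite (_ : (fun h => _) =
    fun h => \sum_(j < q) (f (q * h + (j + r)).+1%N - f (q * h + (j + r))%N)); last first.
  apply/funext => h.
  rewrite -(big_mkord xpredT (fun j => f (q * h + (j + r)).+1%N - f (q * h + (j + r))%N)).
  under eq_bigr do rewrite -addnS -addSn.
  by rewrite telescope_sumr// mulnS -addnA addnCA.
have step (j : 'I_q) : near_poly d M (q%:R ^+ d * g) (q%:R ^+ d * e)
    (fun h => f (q * h + (j + r)).+1%N - f (q * h + (j + r))%N).
  apply: (IH _ _ (fun h => f h.+1 - f h)); apply: near_poly_mono H => //.
  by rewrite addnA leq_add2r addnS mulnS addnC leq_add2r ltnW.
have csum (c : R) : \sum_(j < q) q%:R ^+ d * c = q%:R ^+ d.+1 * c.
  by rewrite sumr_const card_ord exprS -mulrA mulr_natl.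
by have := near_poly_sum (index_enum 'I_q) step; rewrite !csum.
Qed.

Lemma near_poly_raise (R : realType) d k M (g e : R) f :
  near_poly d (M + k.+1) g e f -> near_poly (d + k.+1) M 0 (2 ^+ k.+1 * e) f.
Proof.
elim: k M => [|k IH] M.
  rewrite !addn1 expr1; elim: d f => [|d IHd] f /= H; last exact: IHd.
  move=> h hM; rewrite subr0.
  have h1 := H h (ltnW (hM : (h.+1 < M.+1)%N)); have h2 := H h.+1 hM.
  rewrite (_ : f h.+1 - f h = (f h.+1 - g) - (f h - g)); last by ring.
  by rewrite (le_trans (ler_normB _ _))//; lra.
move=> H; have {}IH : near_poly (d + k.+1) M.+1 0 (2 ^+ k.+1 * e) f.
  by apply: IH; rewrite addSnnS.
rewrite exprS -mulrA addnS; move: (d + k.+1)%N (2 ^+ k.+1 * e) IH => d' e'.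
elim: d' f {H} => [|d' IHd] f /= H; last exact: IHd.
move=> h hM; rewrite subr0.
have h1 := H h (ltnW (hM : (h.+1 < M.+1)%N)); have h2 := H h.+1 hM.
rewrite !subr0 in h1 h2.
by rewrite (le_trans (ler_normB _ _))//; lra.
Qed.

(** By the binomial formula the difference of a j-th power is a combination of
    lower powers, the leading one with coefficient j. *)
Lemma near_poly_exp (R : realType) (k j M : nat) (x : R) : (j <= k)%N ->
  near_poly k M ((k`!)%:R *+ (j == k)) 0 (fun h => (x + h%:R) ^+ j).
Proof.
elim: k j => [|k IH] j.
  by rewrite leqn0 => /eqP -> h hM; rewrite expr0 subrr normr0.
move=> jk /=.
rewrite (_ : (fun h => _) = fun h => \sum_(m < j) 'C(j, m)%:R * (x + h%:R) ^+ m); last first.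
  apply/funext => h; rewrite -natr1 addrA (addrC _ 1) exprDn.
  under eq_bigr do rewrite expr1n mul1r.
  by rewrite big_ord_recr /= binn mulr1n addrK; apply: eq_bigr => m _; rewrite mulr_natl.
have step (m : 'I_j) : near_poly k M ('C(j, m)%:R * (k`!%:R *+ (nat_of_ord m == k))) (`|'C(j, m)%:R| * 0)
    (fun h => 'C(j, m)%:R * (x + h%:R) ^+ m).
  apply: near_polyZ; apply: IH; rewrite -ltnS; apply: leq_trans jk; exact: ltn_ord.
have := near_poly_sum (index_enum 'I_j) step.
rewrite (_ : \sum_(m < j) `|_| * 0 = 0 :> R); last by rewrite big1// => m _; rewrite mulr0.
rewrite (_ : \sum_(m < j) _ = k.+1`!%:R *+ (j == k.+1) :> R)//.
have [jE|jne] := eqVneq j k.+1.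
  rewrite jE big_ord_recr /= eqxx big1 ?add0r; last first.
    by move=> m _; rewrite (ltn_eqF (ltn_ord m)) mulr0.
  by rewrite binSn factS natrM !mulr1n.
rewrite big1// => m _.
have mk : (m < k)%N by have := ltn_ord m; lia.
by rewrite (ltn_eqF mk) mulr0.
Qed.

Lemma near_poly_horner (R : realType) (k M : nat) (c : nat -> R) (x : R) :
  near_poly k M (k`!%:R * c k) 0 (fun h => \sum_(j < k.+1) c j * (x + h%:R) ^+ j).
Proof.
have step (j : 'I_k.+1) : near_poly k M (c j * (k`!%:R *+ (nat_of_ord j == k))) (`|c j| * 0)
    (fun h => c j * (x + h%:R) ^+ j).
  by apply: near_polyZ; apply: near_poly_exp; rewrite -ltnS.
have := near_poly_sum (index_enum 'I_k.+1) step.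
rewrite (_ : \sum_(m < k.+1) `|_| * 0 = 0 :> R); last by rewrite big1// => m _; rewrite mulr0.
rewrite (_ : \sum_(m < k.+1) _ = k`!%:R * c k :> R)//.
rewrite big_ord_recr /= eqxx mulr1n mulrC big1 ?add0r// => m _.
by rewrite (ltn_eqF (ltn_ord m)) mulr0.
Qed.

(** * Vanishing averages of cosines *)

Lemma avg_cos_near (R : realType) (J L : nat -> nat) (f g : nat -> nat -> nat -> R) :
  (forall N, (0 < J N)%N) -> (forall N, (0 < L N)%N) ->
  (forall e, 0 < e -> \forall N \near \oo,
     forall i h, (i < J N)%N -> (h < L N)%N -> `|f N i h - g N i h| <= e) ->
  avg (J N) (L N) (fun i h => cos (g N i h)) @[N --> \oo] --> 0 ->
  avg (J N) (L N) (fun i h => cos (f N i h)) @[N --> \oo] --> 0.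
Proof.
move=> J0 L0 fg /cvgr0Pnorm_le g0; apply/cvgr0Pnorm_le => e e0.
have e2 : 0 < e / 2 by rewrite divr_gt0.
near=> N.
have h1 : `|avg (J N) (L N) (fun i h => cos (g N i h))| <= e / 2.
  by near: N; exact: g0.
have h2 : `|avg (J N) (L N) (fun i h => cos (f N i h) - cos (g N i h))| <= e / 2.
  apply: avg_norm_le => // i h iJ hL.
  rewrite (le_trans (cos_lipschitz _ _))//; move: i h iJ hL.
  by near: N; exact: fg.
move: h2; rewrite avgD avgN => h2.
rewrite -(subrK (avg (J N) (L N) (fun i h => cos (g N i h))) (avg _ _ _)).
by rewrite (le_trans (ler_normD _ _))//; lra.
Unshelve. all: by end_near.
Qed.

Lemma sum_ord_mul (R : realType) (q L : nat) (u : nat -> R) :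
  \sum_(h < q * L) u h = \sum_(r < q) \sum_(h < L) u (q * h + r)%N.
Proof.
elim: L => [|L IH].
  by rewrite muln0 big_ord0 big1// => r _; rewrite big_ord0.
rewrite mulnSr big_split_ord /= IH -big_split /=; apply: eq_bigr => r _.
by rewrite big_ord_recr.
Qed.

Lemma cvg_avg_residues (R : realType) (J L L' : nat -> nat) (q : nat)
    (u : nat -> nat -> nat -> R) : (0 < q)%N ->
  (\forall N \near \oo, L N = (q * L' N)%N) ->
  (forall r, (r < q)%N ->
     avg (J N) (L' N) (fun i h => u N i (q * h + r)%N) @[N --> \oo] --> 0) ->
  avg (J N) (L N) (u N) @[N --> \oo] --> 0.
Proof.
move=> q0 LE Hr.
have H : q%:R^-1 * (\sum_(r < q) avg (J N) (L' N) (fun i h => u N i (q * h + r)%N))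
    @[N --> \oo] --> q%:R^-1 * (\sum_(r < q) 0 : R).
  apply: cvgMr; apply: cvg_big => [|r _]; first exact: add_continuous.
  exact: Hr.
rewrite big1// mulr0 in H; apply: (near_cvg _ H); near=> N.
have -> : L N = (q * L' N)%N by near: N; exact: LE.
rewrite /avg -mulr_suml mulrC -mulrA -invfM -natrM; congr (_ / _%:R).
  rewrite exchange_big; apply: eq_bigr => i _.
  by rewrite -(sum_ord_mul _ _ (u N i)).
by rewrite -mulnA (mulnC (L' N)).
Unshelve. all: by end_near.
Qed.

(** Repeated differencing brings the phase down to m (g N i) with m > 0, up to a
    small error; the average over i then tends to 0 by hypothesis. *)
Lemma avg_cos_top_equidistributed (R : realType) (J L : nat -> nat)
    (d : nat) (g : nat -> nat -> R) (f : nat -> nat -> nat -> R) (p : R) :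
  (forall N, (0 < J N)%N) -> (forall N, (0 < L N)%N) ->
  (L N)%:R @[N --> \oo] --> +oo_R ->
  (forall m p, (0 < m)%N ->
     (\sum_(i < J N) cos (m%:R * g N i + p)) / (J N)%:R @[N --> \oo] --> 0) ->
  (forall C e, 0 < e -> \forall N \near \oo, forall i, (i < J N)%N ->
     near_poly d (L N + C) (g N i) e (f N i)) ->
  avg (J N) (L N) (fun i h => cos (f N i h + p)) @[N --> \oo] --> 0.
Proof.
move=> J0 L0 Loo; elim: d g f p => [|d IH] g f p eq_g np.
  apply: (@avg_cos_near _ _ _ _ (fun N i h => g N i + p)) => //.
    move=> e e0; have := np 0%N e e0; apply: filterS => N H i h iJ hL.
    by rewrite opprD addrACA subrr addr0; apply: H => //; rewrite addn0.
  apply: (near_cvg _ (eq_g 1%N p isT)); near=> N.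
  have -> : avg (J N) (L N) (fun i _ => cos (g N i + p)) =
      (\sum_(i < J N) cos (g N i + p)) * (L N)%:R / (J N * L N)%:R.
    rewrite /avg; congr (_ / _); rewrite mulr_suml; apply: eq_bigr => i _.
    by rewrite sumr_const card_ord mulr_natr.
  rewrite natrM -mulf_div divff ?mulr1 ?pnatr_eq0 -?lt0n//.
  by congr (_ / _); apply: eq_bigr => i _; rewrite mul1r.
apply: van_der_corput => // r r0.
have rR : (0 : R) < r%:R by rewrite ltr0n.
have := IH (fun N i => r%:R * g N i) (fun N i h => f N i (h + r)%N - f N i h) 0.
move=> {}IH; apply: (near_cvg _ (IH _ _)).
- near=> N; apply: eq_avg => i h _ _; congr cos; ring.
- move=> m p' m0; have mr0 : (0 < m * r)%N by rewrite muln_gt0 m0.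
  apply: (near_cvg _ (eq_g _ p' mr0)); near=> N.
  by congr (_ / _); apply: eq_bigr => i _; rewrite natrM mulrA.
- move=> C e e0; have er : 0 < e / r%:R by rewrite divr_gt0.
  have := np (C + r)%N _ er; apply: filterS => N H i iJ.
  have := H i iJ; rewrite addnA => /near_poly_diff.
  by rewrite (mulrC r%:R (e / _)) divfK// lt0r_neq0.
Unshelve. all: by end_near.
Qed.

(** Differencing stops one step earlier than in avg_cos_top_equidistributed: the
    phase is then almost linear with slope m g, and the geometric sums are bounded
    because sin (m g / 2) does not vanish.  The errors accumulate over the whole
    window, hence the tolerance e / L N. *)
Lemma avg_cos_top_irrational (R : realType) (J L : nat -> nat)
    (d : nat) (g : R) (f : nat -> nat -> nat -> R) (p : R) :
  (forall N, (0 < J N)%N) -> (forall N, (0 < L N)%N) ->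
  (L N)%:R @[N --> \oo] --> +oo_R ->
  (forall m, (0 < m)%N -> sin (m%:R * g / 2) != 0) ->
  (forall C e, 0 < e -> \forall N \near \oo, forall i, (i < J N)%N ->
     near_poly d.+1 (L N + C) g (e / (L N)%:R) (f N i)) ->
  avg (J N) (L N) (fun i h => cos (f N i h + p)) @[N --> \oo] --> 0.
Proof.
move=> J0 L0 Loo; elim: d g f p => [|d IH] g f p irr np.
  apply: (@avg_cos_near _ _ _ _ (fun N i h => h%:R * g + (f N i 0%N + p))) => //.
    move=> e e0; have := np 0%N e e0; apply: filterS => N H i h iJ hL.
    rewrite (_ : _ - _ = f N i h - f N i 0%N - h%:R * g); last by ring.
    have LR : (0 : R) < (L N)%:R by rewrite ltr0n.
    apply: (@le_trans _ _ (h%:R * (e / (L N)%:R))); last first.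
      by rewrite mulrCA -[leRHS]mulr1 ler_pM2l// ler_pdivrMr// mul1r ler_nat ltnW.
    elim: h hL => [|h IHh] hL; first by rewrite !mul0r subrr subr0 normr0.
    have := IHh (ltnW hL); have := H i iJ h; rewrite addn0 => /(_ (ltnW hL)).
    move: (e / _) => e1 h1 h2.
    rewrite (_ : _ - _ - _ = (f N i h.+1 - f N i h - g) +
      (f N i h - f N i 0%N - h%:R * g)); last by rewrite -[h.+1%:R]natr1; ring.
    by rewrite (le_trans (ler_normD _ _))// -[h.+1%:R]natr1; lra.
  have s0 : 0 < `|sin (g / 2)| by rewrite normr_gt0; have := irr 1%N isT; rewrite mul1r.
  apply/cvgr0Pnorm_le => e e0; near=> N.
  have LR : (0 : R) < (L N)%:R by rewrite ltr0n.
  have JR : (0 : R) < (J N)%:R by rewrite ltr0n.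
  have eL : 1 / (`|sin (g / 2)| * e) <= (L N)%:R.
    by near: N; move/cvgryPge: Loo; apply.
  rewrite /avg normrM normfV normr_nat natrM ler_pdivrMr ?mulr_gt0//.
  rewrite (le_trans (ler_norm_sum _ _ _))//.
  apply: (@le_trans _ _ (\sum_(i < J N) e * (L N)%:R)); last first.
    by rewrite sumr_const card_ord -(mulr_natr (e * _)) mulrAC mulrA.
  apply: ler_sum => i _.
  rewrite -(ler_pM2l s0) (le_trans (sum_cos_arith_le _ _ _))//.
  by move: eL; rewrite ler_pdivrMr ?mulr_gt0//; lra.
apply: van_der_corput => // r r0.
have rR : (0 : R) < r%:R by rewrite ltr0n.
have := IH (r%:R * g) (fun N i h => f N i (h + r)%N - f N i h) 0.
move=> {}IH; apply: (near_cvg _ (IH _ _)).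
- near=> N; apply: eq_avg => i h _ _; congr cos; ring.
- move=> m m0; have mr0 : (0 < m * r)%N by rewrite muln_gt0 m0.
  by have := irr _ mr0; rewrite natrM -(mulrA m%:R).
- move=> C e e0; have er : 0 < e / r%:R by rewrite divr_gt0.
  have := np (C + r)%N _ er; apply: filterS => N H i iJ.
  have := H i iJ; rewrite addnA => /near_poly_diff.
  by rewrite mulrA (mulrC r%:R (e / _)) divfK// lt0r_neq0.
Unshelve. all: by end_near.
Qed.

(** * Hardy field functions as polynomial plus slow remainder *)

Lemma near_pinftyP (R : realType) (P : R -> Prop) :
  (\forall x \near +oo_R, P x) <-> exists X, forall x, X <= x -> P x.
Proof.
split=> [[X [_ HX]]|[X HX]].
  by exists (X + 1) => x Xx; apply: HX; lra.
by exists X; split; [exact: num_real|move=> x /ltW; exact: HX].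
Qed.

Lemma mean_value (R : realType) (f df : R -> R) (x y : R) :
  x <= y -> (forall z, x <= z <= y -> is_derive z 1 f (df z)) ->
  exists2 z, x <= z <= y & f y - f x = df z * (y - x).
Proof.
move=> xy dfz; have [|z|z] := @MVT_segment R f df x y xy.
- by move=> z; rewrite in_itv /= => /andP[/ltW xz /ltW zy]; apply: dfz; rewrite xz.
- apply: derivable_within_continuous => w; rewrite in_itv /= => /dfz [].
  exact.
- by rewrite in_itv /= => zxy; exists z.
Qed.

(** Only the behaviour near infinity matters, and the half line on which D k is
    differentiable may depend on k. *)
Definition derivative_tower (R : realType) (D : nat -> R -> R) :=
  forall k : nat, \forall x \near +oo_R, is_derive (x : R) 1 (D k) (D k.+1 x).

Lemma derivative_towerN (R : realType) (D : nat -> R -> R) :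
  derivative_tower D -> derivative_tower (fun k x => - D k x).
Proof.
by move=> tD k; have := tD k; apply: filterS => x Dx; exact: is_deriveN.
Qed.

Lemma hardy_tower (R : realType) (F : set (R -> R)) (f : R -> R) :
  hardy_field F -> F f ->
  derivative_tower (fun k => derive1n k f) /\ forall k, F (derive1n k f).
Proof.
move=> hF Ff.
have FD k : F (derive1n k f).
  elim: k => [//|k IH]; exact: (hardy_derive hF IH).2.
split=> // k; have [+ _] := hardy_derive hF (FD k).
by apply: filterS => x /derivableP; rewrite -derive1E.
Qed.

(** A function with an inverse for large arguments has no large zeros, so it
    keeps its sign by the intermediate value theorem. *)
Lemma hardy_sign (R : realType) (F : set (R -> R)) (f : R -> R) :
  hardy_field F -> F f ->
  (\forall x \near +oo_R, 0 <= f x) \/ (\forall x \near +oo_R, f x <= 0).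
Proof.
move=> hF Ff; have [f0|nf0] := pselect (eventually_eq f (fun=> 0)).
  by left; apply: filterS f0 => x ->.
have [g _ fg] := hardy_inv hF Ff nf0.
have [/near_pinftyP[X1 HX1] _] := hardy_derive hF Ff.
have [X2 HX2] := (near_pinftyP _).1 fg.
pose X := Num.max X1 X2.
have nz x : X <= x -> f x != 0.
  rewrite ge_max => /andP[_ /HX2 E]; apply/eqP => fx0.
  by move: E; rewrite fx0 mul0r => /esym/eqP; rewrite oner_eq0.
have sgn x y : X <= x -> X <= y -> 0 < f x -> f y < 0 -> False.
  move=> Xx Xy fx fy.
  have [z zX fz] : exists2 z, X <= z & f z = 0.
    have ct a b : X <= a -> {within `[a, b], continuous f}.
      move=> Xa; apply: derivable_within_continuous => w; rewrite in_itv /= => /andP[aw _].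
      by apply: HX1; rewrite (le_trans _ aw)// (le_trans _ Xa)// le_max lexx.
    case/orP: (le_total x y) => xy.
      have [|z] := @IVT R f x y 0 xy (ct _ _ Xx).
        by rewrite ge_min le_max (ltW fx) (ltW fy) orbT.
      by rewrite in_itv /= => /andP[xz _] fz; exists z => //; exact: le_trans xz.
    have [|z] := @IVT R f y x 0 xy (ct _ _ Xy).
      by rewrite ge_min le_max (ltW fx) (ltW fy) orbT.
    by rewrite in_itv /= => /andP[xz _] fz; exists z => //; exact: le_trans xz.
  by have := nz z zX; rewrite fz eqxx.
have [fX|fX] := lerP 0 (f X); [left|right]; apply/near_pinftyP; exists X => x Xx.
  rewrite leNgt; apply/negP => fx.
  by apply: (sgn X x) => //; rewrite lt_neqAle fX eq_sym nz.
rewrite leNgt; apply/negP => fx; exact: (sgn x X).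
Qed.

Lemma monotone_limit (R : realType) (f df : R -> R) :
  (\forall x \near +oo_R, is_derive (x : R) 1 f (df x)) ->
  (\forall x \near +oo_R, 0 <= df x) ->
  f x @[x --> +oo_R] --> +oo_R \/
  exists2 l, f x @[x --> +oo_R] --> l & \forall x \near +oo_R, f x <= l.
Proof.
move=> /near_pinftyP[X1 H1] /near_pinftyP[X2 H2].
pose X := Num.max X1 X2.
have mono x y : X <= x -> x <= y -> f x <= f y.
  rewrite ge_max => /andP[X1x X2x] xy; rewrite -subr_ge0.
  have [z /andP[xz zy]|z /andP[xz zy] ->] := @mean_value _ f df x y xy.
    exact/H1/(le_trans X1x).
  rewrite mulr_ge0 ?subr_ge0//; exact/H2/(le_trans X2x).
have [[M fM]|nb] := pselect (exists M, forall x, X <= x -> f x <= M).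
  right; pose A := f @` [set x | X <= x].
  have supA : has_sup A.
    split; first by exists (f X), X => /=.
    by exists M => _ [x /= Xx <-]; exact: fM.
  have fl x : X <= x -> f x <= sup A.
    by move=> Xx; apply: (ubP _ _).1 => //; [exact: sup_upper_bound|exists x].
  exists (sup A); last by apply/near_pinftyP; exists X.
  apply/cvgrPdist_le => e e0.
  have [_ [y /= Xy <-] ey] := sup_adherent e0 supA.
  apply/near_pinftyP; exists y => x yx.
  have fyx := mono y x Xy yx; have := fl x (le_trans Xy yx).
  by move=> fx; rewrite ger0_norm; lra.
left; apply/cvgryPge => M.
apply: contrapT => nM; apply: nb; exists M => x Xx.
rewrite leNgt; apply/negP => Mf; apply: nM; apply/near_pinftyP; exists x => y xy.
by rewrite (le_trans (ltW Mf))// mono.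
Qed.

(** Apply the mean value theorem between x / 2 and x, where the derivative is at
    least c (x / 2)^k. *)
Lemma power_growth (R : realType) (f df : R -> R) (k : nat) (c : R) : 0 < c ->
  (\forall x \near +oo_R, is_derive (x : R) 1 f (df x)) ->
  (\forall x \near +oo_R, c * x ^+ k <= df x) ->
  exists2 c', 0 < c' & \forall x \near +oo_R, c' * x ^+ k.+1 <= f x.
Proof.
move=> c0 /near_pinftyP[X1 H1] /near_pinftyP[X2 H2].
pose X := Num.max 1 (Num.max X1 X2).
have [X1X [XX1 XX2]] : 1 <= X /\ X1 <= X /\ X2 <= X.
  by rewrite /X !le_max !lexx !orbT.
have df0 z : X <= z -> 0 <= df z.
  move=> Xz; rewrite (le_trans _ (H2 z (le_trans XX2 Xz)))//.
  by rewrite mulr_ge0 ?(ltW c0)// exprn_ge0// (le_trans _ Xz)// (le_trans _ X1X).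
have c2 : 0 < c / 2 ^+ k.+2 by rewrite divr_gt0// exprn_gt0.
exists (c / 2 ^+ k.+2) => //.
apply/near_pinftyP; exists (Num.max (2 * X) (4 * `|f X| / c)) => x.
rewrite ge_max => /andP[Xx fXx].
pose y := x / 2.
have Xy : X <= y by rewrite /y; lra.
have yx : y <= x by rewrite /y; lra.
have [z /andP[yz zx]|z /andP[yz zx] E1] := @mean_value _ f df y x yx.
  by apply: H1; rewrite (le_trans XX1)// (le_trans Xy).
have [z'|z' /andP[Xz' z'y] E2] := @mean_value _ f df X y Xy.
  by move=> /andP[Xz' _]; apply: H1; rewrite (le_trans XX1).
have y0 : 0 < y by lra.
have yk : 0 <= y ^+ k by rewrite exprn_ge0// ltW.
have fyX : f X <= f y.
  by rewrite -subr_ge0 E2 mulr_ge0 ?subr_ge0// df0.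
have dz : c * y ^+ k <= df z.
  rewrite (le_trans _ (H2 z _))//; last by rewrite (le_trans XX2)// (le_trans Xy).
  by rewrite ler_pM2l// lerXn2r// nnegrE; lra.
have xE : x = 2 * y by rewrite /y; lra.
have E3 : f x - f y = df z * y by rewrite E1 xE; congr (_ * _); lra.
have -> : c / 2 ^+ k.+2 * x ^+ k.+1 = c * y ^+ k * y / 2.
  rewrite xE exprMn !exprS; field; exact: expf_neq0.
have k1 : 1 <= y ^+ k by rewrite exprn_ege1//; lra.
have cy : c * y <= c * y ^+ k * y by rewrite ler_pM2r// -[leLHS]mulr1 ler_pM2l.
have fc : 4 * `|f X| <= c * x by move: fXx; rewrite ler_pdivrMr// (mulrC c).
have fX0 : - `|f X| <= f X by rewrite lerNnormlW.
have dzy : c * y ^+ k * y <= df z * y by rewrite ler_pM2r.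
rewrite xE in fc.
have -> : f x = df z * y + f y by apply/eqP; rewrite -subr_eq E3.
move: dzy cy fc fyX fX0; move: (c * y ^+ k * y) (df z * y) `|f X| (f X) (f y) => u v w t s.
lra.
Qed.

(** Integrating c <= D d with power_growth d times would give D 0 the size of x^d. *)
Lemma no_fast_growth (R : realType) (D : nat -> R -> R) (d : nat) (c : R) :
  derivative_tower D -> D 0%N x / x ^+ d @[x --> +oo_R] --> 0 -> 0 < c ->
  ~ (\forall x \near +oo_R, c <= D d x).
Proof.
move=> tD gr c0 cD.
have H j : (j <= d)%N ->
    exists2 c', 0 < c' & \forall x \near +oo_R, c' * x ^+ j <= D (d - j)%N x.
  elim: j => [_|j IH jd].
    by exists c => //; rewrite subn0; apply: filterS cD => x; rewrite expr0 mulr1.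
  have [c' c'0 Hc] := IH (ltnW jd).
  apply: (@power_growth _ _ (D (d - j)%N) j c') => //.
  by have := tD (d - j.+1)%N; rewrite subnSK.
have [c' c'0] := H d (leqnn d); rewrite subnn => Hc.
have c2 : 0 < c' / 2 by rewrite divr_gt0.
move/cvgr0Pnorm_le : gr => /(_ _ c2) gr.
near (pinfty_nbhs R) => x.
have x0 : 0 < x by near: x; apply: nbhs_pinfty_gt; exact: num_real.
have h1 : c' * x ^+ d <= D 0%N x by near: x.
have h2 : `|D 0%N x / x ^+ d| <= c' / 2 by near: x.
have := ler_norm (D 0%N x / x ^+ d).
have : c' <= D 0%N x / x ^+ d by rewrite ler_pdivlMr// exprn_gt0.
lra.
Unshelve. all: by end_near.
Qed.

(** Each derivative is monotone for large arguments, since the next one keeps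
    its sign; so the d-th has a limit, and no_fast_growth, applied to a and to - a,
    leaves only the limit 0. *)
Lemma eventual_top_derivative (R : realType) (a : R -> R) :
  hardy_union a -> polynomial_growth a ->
  exists D d, [/\ derivative_tower D, D 0%N = a, D d x @[x --> +oo_R] --> 0 &
    (\forall x \near +oo_R, 0 <= D d x) \/ (\forall x \near +oo_R, D d x <= 0)].
Proof.
move=> [F hF Fa] [d _ gr].
have [tD FD] := hardy_tower hF Fa.
exists (fun k => derive1n k a), d; split=> //; last exact: (hardy_sign hF (FD d)).
set D := fun k => derive1n k a in tD *.
have grN : (fun k x => - D k x) 0%N x / x ^+ d @[x --> +oo_R] --> 0.
  have -> : (fun x => - D 0%N x / x ^+ d) = (fun x => - (a x / x ^+ d)).
    by apply/funext => x; rewrite mulNr.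
  by rewrite -oppr0; exact: cvgN.
have no1 c := @no_fast_growth R D d c tD gr.
have no2 c := @no_fast_growth R _ d c (derivative_towerN tD) grN.
have lim0 (l : R) : D d x @[x --> +oo_R] --> l -> D d x @[x --> +oo_R] --> 0.
  move=> Dl; have [l0|l0|<-//] := ltgtP l 0; exfalso.
    apply: (no2 (- l / 2)); first by rewrite divr_gt0// oppr_gt0.
    have l2 : l < l / 2 by lra.
    have H : \forall x \near +oo_R, D d x <= l / 2 by apply: (cvgr_le _ Dl).
    by apply: filterS H => x; lra.
  apply: (no1 (l / 2)); first by rewrite divr_gt0.
  have l2 : l / 2 < l by lra.
  by apply: (cvgr_ge _ Dl).
case: (hardy_sign hF (FD d.+1)) => sD.
  case: (monotone_limit (tD d) sD) => [Doo|[l Dl _]]; last exact: lim0 Dl.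
  by exfalso; apply: (no1 1 ltr01); move/cvgryPge : Doo; apply.
have sD' : \forall x \near +oo_R, 0 <= - D d.+1 x.
  by apply: filterS sD => x; rewrite oppr_ge0.
case: (monotone_limit (derivative_towerN tD d) sD') => [Doo|[l Dl _]].
  by exfalso; apply: (no2 1 ltr01); move/cvgryPge : Doo; apply.
apply: (lim0 (- l)).
have -> : D d = (fun x => - - D d x) by apply/funext => x; rewrite opprK.
exact: cvgN.
Qed.

(** The successive derivatives of l x^d / d!. *)
Definition monomial_tower (R : realType) (l : R) (d k : nat) (x : R) : R :=
  if (k <= d)%N then l / (d - k)`!%:R * x ^+ (d - k) else 0.

Lemma is_derive_monomial_tower (R : realType) (l : R) (d k : nat) (x : R) :
  is_derive x 1 (monomial_tower l d k) (monomial_tower l d k.+1 x).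
Proof.
rewrite /monomial_tower; have [kd|dk|<-] := ltngtP k d.
- have -> : (d - k)%N = (d - k.+1).+1 by rewrite subnSK.
  set n := (d - k.+1)%N.
  have n0 : (n`!%:R : R) != 0 by rewrite pnatr_eq0 -lt0n fact_gt0.
  have n1 : (n.+1%:R : R) != 0 by rewrite pnatr_eq0.
  have dX : is_derive x 1 (@GRing.exp R ^~ n.+1) (n.+1%:R * x ^+ n).
    apply: DeriveDef; first exact: exprn_derivable.
    by rewrite exp_derive /GRing.scale /= mulr1.
  have -> : l / n`!%:R * x ^+ n = (l / n.+1`!%:R) *: (n.+1%:R * x ^+ n).
    rewrite /GRing.scale /= factS natrM invfM.
    by move: (x ^+ n) (n`!%:R) (n.+1%:R) n0 n1 => u v w v0 w0; field; rewrite v0 w0.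
  exact: (is_deriveZ (l / n.+1`!%:R) dX).
- exact: is_derive_cst.
- by rewrite subnn; under eq_fun do rewrite expr0; exact: is_derive_cst.
Qed.

(** The (d - 1)-th derivative is monotone since the d-th keeps its sign.  If it
    is unbounded the process stops with e = d - 1; if it has a finite limit l, then
    subtracting l x^(d-1) / (d-1)! leaves a function whose (d - 1)-th derivative tends to 0
    with constant sign, and the argument goes on one degree lower. *)
Lemma split_leading_polynomial (R : realType) (D : nat -> R -> R) (d : nat) :
  derivative_tower D -> D d x @[x --> +oo_R] --> 0 ->
  (\forall x \near +oo_R, 0 <= D d x) \/ (\forall x \near +oo_R, D d x <= 0) ->
  exists (c : nat -> R) (B : nat -> R -> R), [/\ derivative_tower B,
    forall x, D 0%N x = \sum_(j < d) c j * x ^+ j + B 0%N x &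
    B 0%N x @[x --> +oo_R] --> 0 \/
    exists e, [/\ (e < d)%N, forall j, (j <= e)%N -> c j = 0,
      B e.+1 x @[x --> +oo_R] --> 0 &
      B e x @[x --> +oo_R] --> +oo_R \/ B e x @[x --> +oo_R] --> -oo_R]].
Proof.
elim: d D => [|d IH] D tD D0 sD.
  exists (fun=> 0), D; split=> //; last by left.
  by move=> x; rewrite big_ord0 add0r.
have lim : (D d x @[x --> +oo_R] --> +oo_R \/ D d x @[x --> +oo_R] --> -oo_R) \/
    exists2 l, D d x @[x --> +oo_R] --> l &
      (\forall x \near +oo_R, D d x <= l) \/ (\forall x \near +oo_R, l <= D d x).
  case: sD => sD.
    case: (monotone_limit (tD d) sD) => [Doo|[l Dl Dle]]; first by left; left.
    by right; exists l => //; left.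
  have sD' : \forall x \near +oo_R, 0 <= - D d.+1 x.
    by apply: filterS sD => x; rewrite oppr_ge0.
  have NNE : D d = (fun x => - - D d x) by apply/funext => x; rewrite opprK.
  case: (monotone_limit (derivative_towerN tD d) sD') => [Doo|[l Dl Dle]].
    by left; right; apply/cvgNry.
  right; exists (- l); first by rewrite NNE; exact: cvgN.
  by right; apply: filterS Dle => x; rewrite lerNl.
case: lim => [Doo|[l Dl sl]].
  exists (fun=> 0), D; split=> //; last by right; exists d.
  by move=> x; rewrite big1 ?add0r// => j _; rewrite mul0r.
(* Remove the monomial whose d-th derivative is the limit l. *)
pose D' k x := D k x - monomial_tower l d k x.
have tD' : derivative_tower D'.
  move=> k; have := tD k; apply: filterS => x Dx.
  by apply: is_deriveB; exact: is_derive_monomial_tower.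
have D'd x : D' d x = D d x - l.
  by rewrite /D' /monomial_tower leqnn subnn expr0 mulr1 divr1.
have [c [B [tB DB HB]]] : exists (c : nat -> R) (B : nat -> R -> R), [/\ derivative_tower B,
    forall x, D' 0%N x = \sum_(j < d) c j * x ^+ j + B 0%N x &
    B 0%N x @[x --> +oo_R] --> 0 \/
    exists e, [/\ (e < d)%N, forall j, (j <= e)%N -> c j = 0,
      B e.+1 x @[x --> +oo_R] --> 0 &
      B e x @[x --> +oo_R] --> +oo_R \/ B e x @[x --> +oo_R] --> -oo_R]].
  apply: IH => //.
    under eq_fun do rewrite D'd; rewrite -(subrr l).
    by apply: cvgB => //; exact: cvg_cst.
  case: sl => sl; [right|left]; apply: filterS sl => x; rewrite D'd.
    by rewrite subr_le0.
  by rewrite subr_ge0.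
exists (fun j => if j == d then l / d`!%:R else c j), B; split=> //.
  move=> x; rewrite big_ord_recr /= eqxx -(subrK (monomial_tower l d 0 x) (D 0%N x)).
  rewrite [X in X + _]DB /monomial_tower /= subn0 addrAC; congr (_ + _ + _).
  by apply: eq_bigr => j _; rewrite (ltn_eqF (ltn_ord j)).
case: HB => [HB|[e [ed ce HB Boo]]]; [by left|right].
exists e; split=> //; first exact: ltnW.
by move=> j je; rewrite ltn_eqF ?ce//; exact: leq_ltn_trans ed.
Qed.

(** Iterating the mean value theorem turns unit differences into derivatives. *)
Lemma near_poly_tower (R : realType) (B : nat -> R -> R) (e M : nat) (x b eps : R) :
  (forall k y, (k < e)%N -> x <= y -> is_derive y 1 (B k) (B k.+1 y)) ->
  (forall y, x <= y <= x + (M + e)%:R -> `|B e y - b| <= eps) ->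
  near_poly e M b eps (fun h => B 0%N (x + h%:R)).
Proof.
elim: e B => [|e IH] B dB Be /=.
  by move=> h hM; apply: Be; rewrite lerDl ler0n lerD2l ler_nat addn0 ltnW.
pose B' k y := B k (y + 1) - B k y.
have -> : (fun h => B 0%N (x + h.+1%:R) - B 0%N (x + h%:R)) = (fun h => B' 0%N (x + h%:R)).
  by apply/funext => h; rewrite /B' -natr1 addrA.
apply: IH => [k y ke xy|y /andP[xy yM]].
  have d1 : is_derive (y + 1) 1 (B k) (B k.+1 (y + 1)).
    by apply: dB; [exact: ltnW|rewrite (le_trans xy)// lerDl].
  have d2 := dB k y (ltnW ke) xy.
  apply: is_deriveB; rewrite -[B k.+1 _]mulr1.
  exact: (@is_derive1_comp _ (B k) (shift 1) y _ _ d1 (is_derive_shift y 1 1)).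
have y1 : y <= y + 1 by rewrite lerDl.
have [z /andP[yz _]|z /andP[yz zy] E1] := @mean_value _ (B e) (B e.+1) y (y + 1) y1.
  by apply: dB => //; exact: le_trans yz.
rewrite /B' E1 (_ : y + 1 - y = 1) ?mulr1; last by ring.
apply: Be; rewrite (le_trans xy yz)/=.
by rewrite (le_trans zy)// addnS -natr1 addrA lerD2r.
Qed.

(** * Phases modulo 2 pi and equidistribution of grids *)

(** Says that t / (2 pi) is rational. *)
Definition commensurable_2pi (R : realType) (t : R) :=
  exists2 m : nat, (0 < m)%N & exists z : int, m%:R * t = 2 * pi * z%:~R.

Lemma common_period (R : realType) (t : nat -> R) (d : nat) :
  (forall j, (j < d)%N -> commensurable_2pi (t j)) ->
  exists2 q : nat, (0 < q)%N & forall j, (j < d)%N -> exists z : int, q%:R * t j = 2 * pi * z%:~R.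
Proof.
elim: d => [|d IH] H; first by exists 1%N.
have [q q0 Hq] := IH (fun j jd => H j (ltnW jd)).
have [m m0 [z Hz]] := H d (ltnSn d).
exists (m * q)%N; first by rewrite muln_gt0 m0.
move=> j; rewrite ltnS leq_eqVlt => /orP[/eqP ->|jd].
  by exists (q%:Z * z); rewrite natrM mulrAC Hz intrM; ring.
by have [w Hw] := Hq j jd; exists (m%:Z * w); rewrite natrM -mulrA Hw intrM; ring.
Qed.

Lemma cos_horner_periodic (R : realType) (t : nat -> R) (d q x w : nat) (y : R) :
  (forall j, (j < d)%N -> exists z : int, q%:R * t j = 2 * pi * z%:~R) ->
  cos (\sum_(j < d) t j * (x + q * w)%:R ^+ j + y) =
  cos (\sum_(j < d) t j * x%:R ^+ j + y).
Proof.
move=> H; have [Z ->] : exists Z : int, \sum_(j < d) t j * (x + q * w)%:R ^+ j =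
    \sum_(j < d) t j * x%:R ^+ j + 2 * pi * Z%:~R.
  elim: d H => [|d IH] H; first by exists 0; rewrite !big_ord0 mulr0 addr0.
  have [Z IHZ] := IH (fun j jd => H j (ltnW jd)).
  have [z Hz] := H d (ltnSn d).
  have xle : (x ^ d <= (x + q * w) ^ d)%N by case: d {H IH IHZ Hz} => // d; rewrite leq_exp2r// leq_addr.
  have /dvdnP[W WE] : (q %| (x + q * w) ^ d - x ^ d)%N.
    by rewrite -eqn_mod_dvd// -modnXm addnC mulnC modnMDl modnXm.
  exists (Z + W%:Z * z); rewrite !big_ord_recr /= IHZ.
  have -> : ((x + q * w)%:R : R) ^+ d = x%:R ^+ d + (W * q)%:R.
    by rewrite -WE -!natrX -natrD subnKC.
  rewrite (mulrDr (t d)) natrM (_ : t d * (_ * _) = W%:R * (q%:R * t d)); last by ring.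
  by rewrite Hz intrD intrM; ring.
by rewrite addrAC cosD2piz.
Qed.

(** By the mean value theorem, sin x = x cos z with |z| <= 1. *)
Lemma sin_lower (R : realType) (x : R) : `|x| <= 1 -> cos 1 * `|x| <= `|sin x|.
Proof.
have cosz (z : R) : 0 <= z <= 1 -> cos 1 <= cos z.
  move=> /andP[z0 z1]; have p2 := pi_ge2 R.
  move: z1; rewrite le_eqVlt => /orP[/eqP ->//|z1].
  by rewrite ltW// ltr_cos// in_itv /=; lra.
wlog x0 : x / 0 <= x.
  move=> H; case/orP: (le_total 0 x) => x0; first exact: H.
  rewrite -normrN => x1; have := H (- x); rewrite sinN normrN oppr_ge0.
  by move=> /(_ x0); rewrite normrN; apply; rewrite normrN in x1.
rewrite (ger0_norm x0) => x1.
have [z /andP[z0 zx]] := @mean_value R sin cos 0 x x0 (fun z _ => is_derive_sin z).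
rewrite sin0 !subr0 => ->; rewrite normrM (ger0_norm x0) ler_wpM2r//.
by rewrite (le_trans _ (ler_norm _))// cosz// z0 (le_trans zx).
Qed.

(** A grid of mesh 1 / (N + 1) and length N + 1: the geometric sum is at most of
    order N + 1, against (N + 1)^2 terms. *)
Lemma grid_equidistributed (R : realType) (s : nat -> R) (l p : R) : l != 0 ->
  (\sum_(i < N.+1 ^ 2) cos (l * (s N + i%:R / N.+1%:R) + p)) / (N.+1 ^ 2)%:R
    @[N --> \oo] --> 0.
Proof.
move=> l0; have l1 : 0 < `|l| by rewrite normr_gt0.
have c1 : 0 < cos 1 :> R := cos1_gt0 R.
apply/cvgr0Pnorm_le => e e0; near=> N.
have N0 : (0 : R) < N.+1%:R by rewrite ltr0n.
have N1 : `|l| <= N.+1%:R.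
  apply: (@le_trans _ _ N%:R); last by rewrite ler_nat.
  by near: N; exact: nbhs_infty_ger.
have N2 : 2 / (cos 1 * `|l| * e) <= N.+1%:R.
  apply: (@le_trans _ _ N%:R); last by rewrite ler_nat.
  by near: N; exact: nbhs_infty_ger.
pose x := l / N.+1%:R.
have xh : `|x / 2| = `|l| / N.+1%:R / 2.
  by rewrite !normrM normfV normr_nat (@ger0_norm _ 2^-1).
have x2 : `|x / 2| <= 1.
  rewrite xh ler_pdivrMr// mul1r ler_pdivrMr//; lra.
have sx := sin_lower x2; rewrite xh in sx.
have ge : `|sin (x / 2)| * `|\sum_(i < N.+1 ^ 2) cos (l * (s N + i%:R / N.+1%:R) + p)| <= 1.
  under eq_bigr => i _.
    rewrite (_ : _ + p = i%:R * x + (l * s N + p)); last by rewrite /x; ring.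
    over.
  exact: sum_cos_arith_le.
rewrite normrM normfV normr_nat ler_pdivrMr ?natrX ?exprn_gt0//.
move: N2; rewrite ler_pdivrMr ?mulr_gt0// => N2.
have s0 : 0 < `|sin (x / 2)| by rewrite (lt_le_trans _ sx)// !(mulr_gt0, divr_gt0).
rewrite -(ler_pM2l s0) (le_trans ge)//.
rewrite [leLHS](_ : 1 = (cos 1 * (`|l| / N.+1%:R / 2)) * (2 * N.+1%:R / (cos 1 * `|l|))); last first.
  move: (N.+1%:R : R) (cos 1 : R) `|l| N0 c1 l1 => n c v n0 c0 v0.
  by field; rewrite !lt0r_neq0.
apply: ler_pM => //.
- by apply: ltW; rewrite !(mulr_gt0, divr_gt0).
- by apply: ltW; rewrite divr_gt0 ?mulr_gt0.
rewrite ler_pdivrMr ?mulr_gt0// expr2.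
have : 2 * N.+1%:R <= N.+1%:R * (cos 1 * `|l| * e) * N.+1%:R by rewrite ler_pM2r.
by move: (N.+1%:R) (cos 1) `|l| => n c v; lra.
Unshelve. all: by end_near.
Qed.

(** * Windows on which a function equidistributes *)

(** Factorials make every fixed q divide the length of all large windows. *)
Definition window (N : nat) : nat := N.+1`!.

Lemma window_gt0 N : (0 < window N)%N. Proof. exact: fact_gt0. Qed.

Lemma window_residues (R : realType) (q : nat) : (0 < q)%N ->
  exists L' : nat -> nat, [/\ forall N, (0 < L' N)%N,
    \forall N \near \oo, window N = (q * L' N)%N &
    (L' N)%:R @[N --> \oo] --> +oo_R].
Proof.
move=> q0; exists (fun N => maxn 1 (window N %/ q)).
have wE : \forall N \near \oo, window N = (q * maxn 1 (window N %/ q))%N.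
  exists q => // N /= qN.
  have dv : (q %| window N)%N by apply: dvdn_fact; rewrite q0 (leq_trans qN).
  rewrite (maxn_idPr _); first by rewrite mulnC divnK.
  by rewrite divn_gt0// dvdn_leq// window_gt0.
split=> // [N|]; first by rewrite leq_max.
apply/cvgryPge => A; near=> N.
have : window N = (q * maxn 1 (window N %/ q))%N by near: N.
set m := maxn _ _ => wm.
have NA : A * q%:R <= N%:R by near: N; exact: nbhs_infty_ger.
have q0' : (0 : R) < q%:R by rewrite ltr0n.
rewrite -(ler_pM2r q0') (le_trans NA)// -natrM ler_nat mulnC -wm.
by rewrite /window ltnW// fact_geq.
Unshelve. all: by end_near.
Qed.

Lemma max_witness (P : nat -> Prop) (d : nat) :
  (exists2 k, (k < d)%N & P k) ->
  exists k, [/\ (k < d)%N, P k & forall j, (k < j < d)%N -> ~ P j].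
Proof.
elim: d => [[k]//|d IH] [k kd Pk].
have [Pd|nPd] := pselect (P d).
  by exists d; split=> // j /andP[dj]; rewrite ltnS leqNgt dj.
have kd' : (k < d)%N.
  by rewrite ltn_neqAle -ltnS kd andbT; apply/eqP => kE; apply: nPd; rewrite -kE.
have [k' [k'd Pk' Hk']] := IH (ex_intro2 _ _ k kd' Pk).
exists k'; split=> //; first exact: ltnW.
move=> j /andP[kj]; rewrite ltnS leq_eqVlt => /orP[/eqP -> //|jd].
by apply: Hk'; rewrite kj.
Qed.

(** Errors below this bound stay negligible after multiplication by the length
    of the window. *)
Definition tolerance (R : realType) (N : nat) : R := (N.+1%:R * (window N)%:R)^-1.

(** On a residue class modulo q, a common denominator of the t c_j / (2 pi) with
    j > k, the terms of degree j > k are constant modulo 2 pi.  What remains has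
    k-th difference nearly q^k k! t c_k, an irrational multiple of 2 pi. *)
Lemma avg_cos_irrational_coefficient (R : realType) (a b : R -> R) (c : nat -> R)
    (d e k : nat) (J : nat -> nat) (n : nat -> nat -> nat) (t p : R) :
  (forall N, (0 < J N)%N) ->
  (forall x, a x = \sum_(j < d) c j * x ^+ j + b x) ->
  (forall N i M, near_poly e M 0 (tolerance R N) (fun h => b ((n N i)%:R + h%:R))) ->
  (0 < k < d)%N -> (e <= k)%N ->
  ~ commensurable_2pi (t * c k) ->
  (forall j, (k < j < d)%N -> commensurable_2pi (t * c j)) ->
  avg (J N) (window N) (fun i h => cos (t * a (n N i + h)%:R + p)) @[N --> \oo] --> 0.
Proof.
move=> J0 aE nb /andP[k0 kd] ek irr com.
(* Zeros below k, so that a single period q serves all indices. *)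
pose tc j := if (k < j)%N then t * c j else 0.
have [|q q0 Hq] := @common_period R tc d.
  move=> j jd; rewrite /tc; case: ltnP => kj; first by apply: com; rewrite kj.
  by exists 1%N => //; exists 0; rewrite !mulr0.
have [L' [L'0 wL L'oo]] := window_residues R q0.
apply: (cvg_avg_residues q0 wL) => r rq.
pose f N i h := t * (\sum_(j < k.+1) c j * ((n N i)%:R + h%:R) ^+ j + b ((n N i)%:R + h%:R)).
pose p' N i := \sum_(j < d) tc j * (n N i + r)%:R ^+ j + p.
pose F N i h := f N i (q * h + r)%N + p' N i.
have FE N i h : cos (t * a (n N i + (q * h + r))%:R + p) = cos (F N i h).
  rewrite aE /F /f /p' mulrDr.
  rewrite [RHS](_ : _ = cos (\sum_(j < d) tc j * (n N i + r)%:R ^+ j +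
    (t * \sum_(j < k.+1) c j * ((n N i)%:R + (q * h + r)%:R) ^+ j +
     t * b ((n N i)%:R + (q * h + r)%:R) + p))); last by congr cos; ring.
  rewrite -(@cos_horner_periodic R tc d q _ h)//; congr cos.
  have -> : (n N i + (q * h + r))%N = (n N i + r + q * h)%N by rewrite -addnA (addnC r).
  rewrite -natrD (_ : (n N i + (q * h + r))%N = (n N i + r + q * h)%N); last first.
    by rewrite -addnA (addnC r).
  rewrite !addrA; congr (_ + _ + _).
  set x := (_ + _)%:R.
  rewrite !mulr_sumr -(big_mkord xpredT (fun j => t * (c j * x ^+ j))).
  rewrite -(big_mkord xpredT (fun j => tc j * x ^+ j)).
  rewrite -(big_mkord xpredT (fun j => t * (c j * x ^+ j))).
  rewrite (@big_cat_nat _ _ _ k.+1)//= [X in _ = X + _](@big_cat_nat _ _ _ k.+1)//=.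
  have -> : \sum_(0 <= j < k.+1) tc j * x ^+ j = 0.
    rewrite big_nat big1// => j jk; rewrite /tc (_ : (k < j)%N = false) ?mul0r//.
    by apply/negbTE; lia.
  rewrite add0r.
  rewrite addrC; congr (_ + _); apply: eq_big_nat => j /andP[kj _].
  by rewrite /tc kj mulrA.
have -> : (fun N => avg (J N) (L' N) (fun i h => cos (t * a (n N i + (q * h + r))%:R + p))) =
    (fun N => avg (J N) (L' N) (fun i h => cos (F N i h + 0))).
  by apply/funext => N; apply: eq_avg => i h _ _; rewrite FE addr0.
case: k k0 kd ek irr com @tc Hq @f @p' @F FE => // k _ kd ek irr com tc Hq f p' F FE.
apply: (@avg_cos_top_irrational R J L' k (q%:R ^+ k.+1 * (t * (k.+1`!%:R * c k.+1 + 0)))) => //.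
  move=> m m0; apply/eqP => /sin_eq0_pi [z zE]; apply: irr.
  exists (m * (q ^ k.+1 * k.+1`!))%N; first by rewrite !muln_gt0 m0 expn_gt0 q0 fact_gt0.
  by exists z; rewrite 2!natrM natrX -(mulrA 2) -zE addr0; field.
move=> C eps eps0.
pose K : R := q%:R ^+ k.+1 * (`|t| * 2 ^+ (k.+1 - e)).
near=> N => i iJ.
have npf M : near_poly k.+1 M (t * (k.+1`!%:R * c k.+1 + 0))
    (`|t| * (0 + 2 ^+ (k.+1 - e) * tolerance R N)) (f N i).
  apply: near_polyZ; apply: near_polyD; first exact: near_poly_horner.
  have [ke|ke] := leqP k.+1 e.
    have -> : (k.+1 - e = 0)%N by apply/eqP; rewrite subn_eq0.
    have kE : k.+1 = e by apply/eqP; rewrite eqn_leq ke ek.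
    by rewrite expr0 mul1r kE; exact: nb.
  have kE : (k.+1 = e + (k - e).+1)%N by rewrite addnS subnKC.
  rewrite (_ : (k.+1 - e = (k - e).+1)%N); last by rewrite subSn.
  by rewrite {1}kE; apply: near_poly_raise; exact: nb.
have := @near_poly_subst R k.+1 (L' N + C) q r _ _ _ q0 (npf _).
move=> /near_polyD/(_ (near_poly_cst k.+1 (L' N + C) (p' N i))).
rewrite mulr0n addr0; apply: near_poly_mono => //.
have LR : (0 : R) < (L' N)%:R by rewrite ltr0n.
have NR : (0 : R) < N.+1%:R by rewrite ltr0n.
have qR : (0 : R) < q%:R by rewrite ltr0n.
have wE : window N = (q * L' N)%N by near: N.
have NK : K / eps <= N.+1%:R.
  apply: (@le_trans _ _ N%:R); last by rewrite ler_nat.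
  by near: N; exact: nbhs_infty_ger.
rewrite addr0 add0r /tolerance wE natrM.
rewrite [leLHS](_ : _ = K / N.+1%:R / q%:R / (L' N)%:R); last first.
  by rewrite /K; field; rewrite !lt0r_neq0.
rewrite ler_pM2r ?invr_gt0// ler_pdivrMr//.
have {}NK : K / N.+1%:R <= eps by rewrite ler_pdivrMr// (mulrC eps) -ler_pdivrMr.
rewrite (le_trans NK)//.
by rewrite -[leLHS]mulr1 ler_pM2l// ler1n.
Unshelve. all: by end_near.
Qed.

Lemma tolerance_gt0 (R : realType) N : 0 < tolerance R N.
Proof. by rewrite invr_gt0 mulr_gt0 ?ltr0n// window_gt0. Qed.

(** Beyond a point where the derivative of order e + 1 is below the tolerance, the
    e-th derivative is continuous and unbounded, so it takes each value of a grid
    of mesh 1 / (N + 1).  Rounding the arguments down to multiples of the window length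
    changes these values very little. *)
Lemma sample_windows (R : realType) (B : nat -> R -> R) (e : nat) :
  derivative_tower B -> B e.+1 x @[x --> +oo_R] --> 0 ->
  B e x @[x --> +oo_R] --> +oo_R ->
  exists (n : nat -> nat -> nat) (s : nat -> R), forall N i,
    [/\ (N <= n N i)%N, (window N %| n N i)%N,
      forall (k : nat) (y : R), (k <= e)%N -> (n N i)%:R <= y -> is_derive y 1 (B k) (B k.+1 y),
      forall y : R, (n N i)%:R <= y -> `|B e.+1 y| <= tolerance R N &
      forall y : R, (n N i)%:R <= y -> `|B e y - (s N + i%:R / N.+1%:R)| <=
         tolerance R N * (y - (n N i)%:R + (window N)%:R)].
Proof.
move=> tB B0 Boo.
have thr N : exists X : R, [/\ N%:R <= X,
    forall (k : nat) (y : R), (k <= e)%N -> X <= y -> is_derive y 1 (B k) (B k.+1 y) &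
    forall y : R, X <= y -> `|B e.+1 y| <= tolerance R N].
  move/cvgr0Pnorm_le : B0 => /(_ _ (tolerance_gt0 R N))/near_pinftyP[X1 H1].
  have [X2 H2] : exists X, forall (k : nat) (y : R), (k <= e)%N -> X <= y -> is_derive y 1 (B k) (B k.+1 y).
    elim: e {Boo X1 H1} => [|e [X HX]].
      have [X HX] := (near_pinftyP _).1 (tB 0%N).
      by exists X => k y; rewrite leqn0 => /eqP ->; exact: HX.
    have [X' HX'] := (near_pinftyP _).1 (tB e.+1).
    exists (Num.max X X') => k y; rewrite ge_max leq_eqVlt => /orP[/eqP -> | ke] /andP[Xy X'y].
      exact: HX'.
    exact: HX.
  exists (Num.max N%:R (Num.max X1 X2)); split.
  - by rewrite le_max lexx.
  - by move=> k y ke; rewrite !ge_max => /andP[_ /andP[_ X2y]]; exact: H2.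
  - by move=> y; rewrite !ge_max => /andP[_ /andP[X1y _]]; exact: H1.
pose X N : R := sval (cid (thr N)).
have XP N : [/\ N%:R <= X N,
    forall (k : nat) (y : R), (k <= e)%N -> X N <= y -> is_derive y 1 (B k) (B k.+1 y) &
    forall y : R, X N <= y -> `|B e.+1 y| <= tolerance R N] by exact: (svalP (cid (thr N))).
(* The margin keeps the rounded arguments beyond X N. *)
pose X' N := X N + (window N)%:R.
pose s N := B e (X' N).
have XX' N : X N <= X' N by rewrite lerDl.
have pt N i : exists2 x, X' N <= x & B e x = s N + i%:R / N.+1%:R.
  have [_ dB _] := XP N.
  move/cvgryPge : Boo => /(_ (s N + i%:R / N.+1%:R)) /near_pinftyP[Y HY].
  pose Z := Num.max Y (X' N).
  have XZ : X' N <= Z by rewrite le_max lexx orbT.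
  have [||x] := @IVT R (B e) (X' N) Z (s N + i%:R / N.+1%:R) XZ.
  - apply: derivable_within_continuous => w; rewrite in_itv /= => /andP[Xw _].
    by have [] := dB e w (leqnn e) (le_trans (XX' N) Xw).
  - have h1 : s N + i%:R / N.+1%:R <= B e Z by apply: HY; rewrite le_max lexx.
    by rewrite ge_min le_max h1 orbT andbT /s lerDl divr_ge0.
  - by rewrite in_itv /= => /andP[Xx _] Bx; exists x.
pose x N i := sval (cid2 (pt N i)).
have xP N i : X' N <= x N i /\ B e (x N i) = s N + i%:R / N.+1%:R.
  by rewrite /x; case: (cid2 (pt N i)).
exists (fun N i => Num.truncn (x N i / (window N)%:R) * window N)%N, s => N i.
have [NX dB B1] := XP N; have [Xx Bx] := xP N i.
set w := window N; set n := (_ * _)%N.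
have wR : (0 : R) < w%:R by rewrite ltr0n window_gt0.
have XN0 : 0 <= X N by rewrite (le_trans _ NX).
have xw0 : 0 <= x N i / w%:R by rewrite divr_ge0// (le_trans _ Xx)// (le_trans XN0).
have /andP[n1 n2] := truncn_itv xw0.
have nx : n%:R <= x N i by rewrite natrM -ler_pdivlMr.
have xn : x N i <= n%:R + w%:R.
  by rewrite natrM -[X in _ + X]mul1r -mulrDl natr1 -ler_pdivrMr// ltW.
have Xn : X N <= n%:R by rewrite /X' -/w in Xx; lra.
split.
- by rewrite -(ler_nat R) (le_trans NX).
- by rewrite dvdn_mull.
- by move=> k y ke ny; apply: dB => //; exact: le_trans ny.
- by move=> y ny; apply: B1; exact: le_trans ny.
move=> y ny; rewrite -Bx.
have Xy : X N <= y := le_trans Xn ny.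
have Xx' : X N <= x N i := le_trans Xn nx.
have mv u v : X N <= u -> u <= v -> `|B e v - B e u| <= tolerance R N * (v - u).
  move=> Xu uv; have [z /andP[uz _]|z /andP[uz _] ->] := @mean_value _ (B e) (B e.+1) u v uv.
    by apply: dB => //; exact: le_trans uz.
  by rewrite normrM (ger0_norm (_ : 0 <= v - u)) ?subr_ge0// ler_wpM2r ?subr_ge0// B1// (le_trans Xu).
have tol := tolerance_gt0 R N.
case/orP: (le_total (x N i) y) => xy.
  rewrite (le_trans (mv _ _ Xx' xy))// ler_pM2l//; lra.
rewrite distrC (le_trans (mv _ _ Xy xy))// ler_pM2l//; lra.
Qed.

(** Since q divides n N i, the polynomial part of the phase only depends, modulo
    2 pi, on the residue r.  The e-th differences of what remains are close to
    t q^e times the values of the grid. *)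
Lemma avg_cos_rational_coefficients (R : realType) (a : R -> R)
    (B : nat -> R -> R) (c : nat -> R) (d e : nat) (n : nat -> nat -> nat)
    (s : nat -> R) (t p : R) : t != 0 ->
  (forall x, a x = \sum_(j < d) c j * x ^+ j + B 0%N x) ->
  (forall j, (j < d)%N -> commensurable_2pi (t * c j)) ->
  (forall N i,
    [/\ (window N %| n N i)%N,
      forall (k : nat) (y : R), (k < e)%N -> (n N i)%:R <= y -> is_derive y 1 (B k) (B k.+1 y) &
      forall y : R, (n N i)%:R <= y -> `|B e y - (s N + i%:R / N.+1%:R)| <=
         tolerance R N * (y - (n N i)%:R + (window N)%:R)]) ->
  avg (N.+1 ^ 2)%N (window N) (fun i h => cos (t * a (n N i + h)%:R + p)) @[N --> \oo] --> 0.
Proof.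
move=> t0 aE com nP.
have J0 N : (0 < N.+1 ^ 2)%N by rewrite expn_gt0.
have [q q0 Hq] := common_period com.
have [L' [L'0 wL L'oo]] := window_residues R q0.
apply: (cvg_avg_residues q0 wL) => r rq.
pose f N i h := t * B 0%N ((n N i)%:R + (q * h + r)%:R).
pose p' := \sum_(j < d) t * c j * r%:R ^+ j + p.
have qR : (0 : R) < q%:R by rewrite ltr0n.
apply: (near_cvg (f := fun N => avg (N.+1 ^ 2)%N (L' N) (fun i h => cos (f N i h + p')))).
  near=> N; apply: eq_avg => i h _ _.
  have qn : (q %| n N i)%N.
    have [dn _ _] := nP N i; apply: dvdn_trans dn; apply: dvdn_fact; rewrite q0/=.
    by rewrite leqW//; near: N; exact: nbhs_infty_ge.
  rewrite aE mulrDr mulr_sumr -addrA.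
  under eq_bigr do rewrite mulrA.
  have nE : (n N i + (q * h + r) = r + q * (n N i %/ q + h))%N.
    by rewrite mulnDr [(q * (_ %/ _))%N]mulnC divnK//; lia.
  have := @cos_horner_periodic R (fun j => t * c j) d q r (n N i %/ q + h)%N
    (t * B 0%N (n N i + (q * h + r))%:R + p) Hq.
  rewrite -nE /= => ->.
  by rewrite /f /p' -natrD; congr cos; ring.
have tq0 : t * q%:R ^+ e != 0 by rewrite mulf_neq0// expf_neq0// lt0r_neq0.
apply: (@avg_cos_top_equidistributed R _ L' e
  (fun N i => q%:R ^+ e * (t * (s N + i%:R / N.+1%:R)))) => //.
  move=> m p1 m0.
  have l0 : m%:R * (q%:R ^+ e * t) != 0.
    by rewrite mulf_neq0 ?pnatr_eq0 -?lt0n// mulrC.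
  apply: (near_cvg _ (grid_equidistributed s p1 l0)); near=> N.
  by congr (_ / _); apply: eq_bigr => i _; congr (cos (_ + _)); ring.
move=> C eps eps0.
pose K : R := q%:R ^+ e * (`|t| * (2 + (q * (C + e) + r + e)%:R)).
near=> N => i iJ.
have [_ dB Be] := nP N i.
have wE : window N = (q * L' N)%N by near: N.
pose M := (q * (L' N + C + e) + r)%N.
have npB : near_poly e M (s N + i%:R / N.+1%:R) (tolerance R N * ((M + e)%:R + (window N)%:R))
    (fun h => B 0%N ((n N i)%:R + h%:R)).
  apply: (near_poly_tower dB) => y /andP[ny yM].
  rewrite (le_trans (Be y ny))// ler_pM2l ?tolerance_gt0//; lra.
have := near_poly_subst q0 (near_polyZ t npB).
apply: near_poly_mono => //.
have LR : (0 : R) < (L' N)%:R by rewrite ltr0n.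
have NR : (0 : R) < N.+1%:R by rewrite ltr0n.
have wR : (1 : R) <= (window N)%:R by rewrite ler1n window_gt0.
have w0 : (0 : R) < (window N)%:R by rewrite ltr0n window_gt0.
have NK : K / eps <= N.+1%:R.
  apply: (@le_trans _ _ N%:R); last by rewrite ler_nat.
  by near: N; exact: nbhs_infty_ger.
have {}NK : K / N.+1%:R <= eps by rewrite ler_pdivrMr// (mulrC eps) -ler_pdivrMr.
rewrite (le_trans _ NK)//.
have -> : ((M + e)%:R : R) = (window N)%:R + (q * (C + e) + r + e)%:R.
  by rewrite -natrD wE /M; congr _%:R; lia.
set W := (window N)%:R; set E := (_ + e)%:R.
rewrite /K /tolerance -/W -/E invfM.
rewrite [leRHS](_ : _ = q%:R ^+ e * (`|t| * (N.+1%:R^-1 * W^-1 * (W * (2 + E))))); last first.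
  by field; rewrite !lt0r_neq0.
have NW0 : 0 <= N.+1%:R^-1 * W^-1 by rewrite ltW// mulr_gt0// invr_gt0.
rewrite ler_pM2l ?exprn_gt0// ler_wpM2l// ler_wpM2l//.
have : E <= W * E by rewrite ler_peMl.
lra.
Unshelve. all: by end_near.
Qed.

(** Phases p are included so that sines are covered along with cosines. *)
Definition equidistributing_windows (R : realType) (a : R -> R) (J : nat -> nat)
    (n : nat -> nat -> nat) : Prop :=
  [/\ forall N, (0 < J N)%N, forall N i, (N <= n N i)%N &
    forall t p, t != 0 ->
      avg (J N) (window N) (fun i h => cos (t * a (n N i + h)%:R + p)) @[N --> \oo] --> 0].

(** The terms of P have degree > e, so an irrational coefficient c_k has k > e and
    the differences of order k of the remainder are negligible. *)
Lemma windows_of_divergent_derivative (R : realType) (a : R -> R)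
    (B : nat -> R -> R) (c : nat -> R) (d e : nat) :
  (forall x, a x = \sum_(j < d) c j * x ^+ j + B 0%N x) ->
  (forall j, (j <= e)%N -> c j = 0) ->
  derivative_tower B -> B e.+1 x @[x --> +oo_R] --> 0 ->
  B e x @[x --> +oo_R] --> +oo_R ->
  exists J n, equidistributing_windows a J n.
Proof.
move=> aE c0 tB B0 Boo; have [n [s nP]] := sample_windows tB B0 Boo.
exists (fun N => N.+1 ^ 2)%N, n; split=> [N|N i|t p t0].
- by rewrite /= expn_gt0.
- by have [] := nP N i.
have [[k kd Pk]|no] := pselect (exists2 k, (k < d)%N & ~ commensurable_2pi (t * c k)).
  have [{Pk}k [{}kd irr max]] :=
    @max_witness (fun k => ~ commensurable_2pi (t * c k)) d (ex_intro2 _ _ k kd Pk).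
  have ek : (e < k)%N.
    rewrite ltnNge; apply/negP => ke; apply: irr; rewrite c0// mulr0.
    by exists 1%N => //; exists 0; rewrite !mulr0.
  apply: (@avg_cos_irrational_coefficient R a (B 0%N) c d e.+1 k) => //.
  - move=> N i M; have [_ _ dB B1 _] := nP N i.
    by apply: near_poly_tower => y /andP[ny _]; rewrite subr0; exact: B1.
  - by rewrite kd (leq_ltn_trans _ ek).
  - by move=> j jkd; apply: contrapT; exact: max.
apply: (@avg_cos_rational_coefficients R a B c d e n s) => // [j jd|N i].
  by apply: contrapT => H; apply: no; exists j.
have [_ dn dB _ Be] := nP N i; split=> // k y ke; exact/dB/ltnW.
Qed.

(** Otherwise a common period q turns P - c_0 into the real multiple
    2 pi / (q t) of an integer polynomial, from which a stays at bounded distance. *)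
Lemma irrational_coefficient (R : realType) (a b : R -> R) (c : nat -> R) (d : nat)
    (t : R) : t != 0 ->
  (forall x, a x = \sum_(j < d) c j * x ^+ j + b x) ->
  b x @[x --> +oo_R] --> 0 ->
  (forall (p : {poly int}) (r : R),
     `|a x - r * (map_poly (intr : int -> R) p).[x]| @[x --> +oo_R] --> +oo_R) ->
  exists2 k, (k < d)%N & (0 < k)%N /\ ~ commensurable_2pi (t * c k).
Proof.
move=> t0 aE b0 far; apply: contrapT => no.
have [|q q0 Hq] := @common_period R (fun j => if j == 0%N then 0 else t * c j) d.
  move=> j jd; case: eqVneq => [_|j0].
    by exists 1%N => //; exists 0; rewrite !mulr0.
  apply: contrapT => irr; apply: no; exists j => //; split=> //.
  by rewrite lt0n.
have p0 := pi_gt0 R.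
have qR : (0 : R) < q%:R by rewrite ltr0n.
have zP j : exists z : int, (j < d)%N -> q%:R * (if j == 0%N then 0 else t * c j) = 2 * pi * z%:~R.
  have [jd|jd] := ltnP j d; last by exists 0.
  by have [z Hz] := Hq j jd; exists z.
have [w wP] := choice zP.
pose z j := if j == 0%N then 0 else w j.
pose r := 2 * pi / (q%:R * t).
have rz j : (j < d)%N -> (0 < j)%N -> c j = r * (z j)%:~R.
  move=> jd; rewrite lt0n => j0; rewrite /z (negbTE j0).
  have := wP j jd; rewrite (negbTE j0) => E.
  by rewrite /r mulrAC -E; field; rewrite t0 lt0r_neq0.
pose P := \poly_(j < d) z j.
have PE x : (map_poly (intr : int -> R) P).[x] = \sum_(j < d) (z j)%:~R * x ^+ j.
  have -> : map_poly (intr : int -> R) P = \poly_(j < d) (z j)%:~R.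
    by apply/polyP => j; rewrite coef_map !coef_poly; case: ifP.
  by rewrite horner_poly.
have bnd : \forall x \near +oo_R, `|a x - r * (map_poly (intr : int -> R) P).[x]| <= `|c 0%N| + 1.
  move/cvgr0Pnorm_le : b0 => /(_ 1 ltr01); apply: filterS => x bx.
  have [d0|d0] := posnP d.
    rewrite aE PE d0 !big_ord0 mulr0 subr0 add0r (le_trans bx)//.
    by rewrite lerDr.
  have -> : a x - r * (map_poly (intr : int -> R) P).[x] = c 0%N + b x.
    rewrite aE PE -(prednK d0) !big_ord_recl /= expr0 mulr1 {1}/z eqxx mulr0z mul0r add0r.
    rewrite mulr_sumr (_ : \sum_(i < d.-1) r * _ = \sum_(i < d.-1) c (bump 0 i) * x ^+ bump 0 i).
      by ring.
    apply: eq_bigr => i _; rewrite mulrA -rz// /bump/= add1n.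
    by have := ltn_ord i; lia.
  by rewrite (le_trans (ler_normD _ _))// lerD2l.
have := far P r; move/cvgryPge => /(_ (`|c 0%N| + 2)) big.
near (pinfty_nbhs R) => x.
have h1 : `|a x - r * (map_poly (intr : int -> R) P).[x]| <= `|c 0%N| + 1 by near: x.
have h2 : `|c 0%N| + 2 <= `|a x - r * (map_poly (intr : int -> R) P).[x]| by near: x.
by have := le_trans h2 h1; lra.
Unshelve. all: by end_near.
Qed.

Lemma exists_equidistributing_windows (R : realType) (a : R -> R) :
  hardy_union a -> polynomial_growth a ->
  (forall (p : {poly int}) (r : R),
     `|a x - r * (map_poly (intr : int -> R) p).[x]| @[x --> +oo_R] --> +oo_R) ->
  exists J n, equidistributing_windows a J n.
Proof.
move=> ha ga far.
have [D [d [tD D0a D0 sD]]] := eventual_top_derivative ha ga.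
have [c [B [tB DE [B0|[e [_ c0 B0 [Boo|Boo]]]]]]] := split_leading_polynomial tD D0 sD.
- have aE x : a x = \sum_(j < d) c j * x ^+ j + B 0%N x by rewrite -D0a.
  have thr N : exists X : nat, forall y : R, X%:R <= y -> `|B 0%N y| <= tolerance R N.
    have /near_pinftyP[X HX] : \forall y \near +oo_R, `|B 0%N y| <= tolerance R N.
      by move/cvgr0Pnorm_le : B0; apply; exact: tolerance_gt0.
    exists (Num.truncn X).+1 => y Xy.
    by apply: HX; rewrite (le_trans _ Xy)// ltW// truncnS_gt.
  pose n N (i : nat) := maxn N (sval (cid (thr N))).
  exists (fun=> 1%N), n; split=> // [N i|t p t0]; first exact: leq_maxl.
  have [k kd [k0 Pk]] := irrational_coefficient t0 aE B0 far.
  have [{kd k0 Pk}k [kd [k0 irr] max]] :=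
    @max_witness (fun k => (0 < k)%N /\ ~ commensurable_2pi (t * c k)) d
      (ex_intro2 _ _ k kd (conj k0 Pk)).
  apply: (@avg_cos_irrational_coefficient R a (B 0%N) c d 0 k) => //.
  + move=> N i M h hM; rewrite subr0; apply: (svalP (cid (thr N))).
    by rewrite (@le_trans _ _ (n N i)%:R) ?lerDl// ler_nat leq_maxr.
  + by rewrite k0.
  + move=> j jkd; apply: contrapT => nj; apply: (max j jkd); split=> //.
    by case/andP: jkd => kj _; exact: leq_ltn_trans kj.
- by apply: (windows_of_divergent_derivative _ c0 tB B0 Boo) => x; rewrite -D0a.
have [J [n [J0 nN eq_n]]] : exists J n, equidistributing_windows (fun x => - a x) J n.
  apply: (@windows_of_divergent_derivative R _ (fun k x => - B k x) (fun j => - c j) d e).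
  - move=> x; rewrite -D0a DE opprD -sumrN; congr (_ + _).
    by apply: eq_bigr => j _; rewrite mulNr.
  - by move=> j je; rewrite c0 ?oppr0.
  - exact: derivative_towerN.
  - by rewrite -oppr0; exact: cvgN.
  - exact/cvgNry.
exists J, n; split=> // t p t0.
have t0' : - t != 0 by rewrite oppr_eq0.
apply: (near_cvg _ (eq_n (- t) p t0')); near=> N.
by apply: eq_avg => i h _ _; rewrite mulrNN.
Unshelve. all: by end_near.
Qed.

(** * Fejer weights *)

Lemma pi2_neq0 (R : realType) : 2 * pi != 0 :> R.
Proof. by rewrite lt0r_neq0// mulr_gt0// pi_gt0. Qed.

Definition fejer (R : realType) (m : nat) (z : R) : R :=
  ((\sum_(j < m) cos (j%:R * (2 * pi * z))) ^+ 2 +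
   (\sum_(j < m) sin (j%:R * (2 * pi * z))) ^+ 2) / m%:R.

Lemma fejer_ge0 (R : realType) m (z : R) : 0 <= fejer m z.
Proof. by rewrite divr_ge0// addr_ge0// sqr_ge0. Qed.

Lemma fejerE (R : realType) m (z : R) :
  fejer m z = m%:R^-1 * \sum_(j < m) \sum_(k < m) cos (2 * pi * (j%:R - k%:R) * z).
Proof.
rewrite /fejer mulrC; congr (_ * _); rewrite !expr2 !big_distrlr /= -big_split /=.
apply: eq_bigr => j _; rewrite -big_split /=; apply: eq_bigr => k _.
by rewrite -cosB; congr cos; ring.
Qed.

(** The fractional part of z is at least 2 d, so z - d stays at distance at least d
    from the integers, where the geometric sums are at most 1 / sin (pi d). *)
Lemma fejer_far (R : realType) (m : nat) (z d : R) : (0 < m)%N -> 0 < d -> d <= 1 / 4 ->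
  2 * d <= z - (Num.floor z)%:~R ->
  fejer m (z - d) <= 2 / (m%:R * sin (pi * d) ^+ 2).
Proof.
move=> m0 d0 d4 dz; have p0 := pi_gt0 R.
have sd0 : 0 < sin (pi * d) by apply: sin_gt0_pi; rewrite mulr_gt0//=; nra.
have /andP[f1 f2] := floor_itv z.
move: f2; rewrite intrD mulr1z; set x := z - (Num.floor z)%:~R in dz * => f2.
have x1 : x < 1 by rewrite /x ltrBlDl.
have sE : sin (pi * d) <= `|sin (pi * (z - d))|.
  have -> : pi * (z - d) = pi * (x - d) + pi * (Num.floor z)%:~R by rewrite /x; ring.
  rewrite sinDpiz (le_trans _ (ler_norm _))//.
  have mon u : d <= u -> u <= 1 / 2 -> sin (pi * d) <= sin (pi * u).
    rewrite le_eqVlt => /orP[/eqP -> //|du u2].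
    have itv (v : R) : 0 < v -> v <= 1 / 2 -> pi * v \in `[- (pi / 2), pi / 2]%R.
      move=> v0 v2; have := ler_wpM2l (ltW p0) v2; have := mulr_gt0 p0 v0.
      by rewrite in_itv /= => h1 h2; apply/andP; split; lra.
    by rewrite ltW// ltr_sin ?ltr_pM2l// itv//; lra.
  have [h|h] := lerP (x - d) (1 / 2); first by apply: mon => //; lra.
  have -> : sin (pi * (x - d)) = sin (pi * (1 - (x - d))).
    rewrite (_ : pi * (1 - _) = - (pi * (x - d)) + pi); last by ring.
    by rewrite sinDpi sinN opprK.
  by apply: mon; lra.
have mR : (0 : R) < m%:R by rewrite ltr0n.
have half : 2 * pi * (z - d) / 2 = pi * (z - d) by field.
have C1 := sum_cos_arith_le (2 * pi * (z - d)) 0 m.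
have S1 := sum_sin_arith_le (2 * pi * (z - d)) 0 m.
rewrite half in C1 S1.
have s0 : 0 < `|sin (pi * (z - d))| := lt_le_trans sd0 sE.
rewrite /fejer ler_pdivrMr//.
rewrite [leRHS](_ : _ = 2 / sin (pi * d) ^+ 2); last first.
  by field; rewrite !lt0r_neq0.
rewrite ler_pdivlMr ?exprn_gt0//.
have sq u : `|sin (pi * (z - d))| * `|u| <= 1 -> u ^+ 2 * sin (pi * d) ^+ 2 <= 1.
  move=> H; rewrite -exprMn -[leRHS](expr1n _ 2) -[leLHS]real_normK ?num_real//.
  rewrite lerXn2r ?nnegrE// normrM (le_trans _ H)// mulrC ler_wpM2r// gtr0_norm//.
have {}C1 := sq _ C1; have {}S1 := sq _ S1.
have z0 (F : R -> R) : \sum_(j < m) F (j%:R * (2 * pi * (z - d)) + 0) =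
    \sum_(j < m) F (j%:R * (2 * pi * (z - d))).
  by apply: eq_bigr => j _; rewrite addr0.
by rewrite z0 in C1; rewrite z0 in S1; rewrite mulrDl; lra.
Qed.

Lemma cosM (R : realType) (x y : R) : cos x * cos y = 1 / 2 * (cos (x + y) + cos (x - y)).
Proof. by rewrite cosD cosB; field. Qed.

(** In the double sum for the kernel only the diagonal survives. *)
Lemma cvg_avg_fejer (R : realType) (a : R -> R) J n (m : nat) (d : R) :
  (0 < m)%N -> equidistributing_windows a J n ->
  avg (J N) (window N) (fun i h => fejer m (a (n N i + h)%:R - d)) @[N --> \oo] --> (1 : R).
Proof.
move=> m0 [J0 _ eq_n].
pose A N (j k : nat) := avg (J N) (window N)
  (fun i h => cos (2 * pi * (j%:R - k%:R) * (a (n N i + h)%:R - d))).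
have lim (j k : 'I_m) : A N j k @[N --> \oo] --> ((j == k)%:R : R).
  have [->|jk] := eqVneq j k.
    apply: cvg_near_cst; near=> N; rewrite /A.
    under eq_avg do rewrite subrr mulr0 mul0r cos0.
    by rewrite avg_cst// window_gt0.
  have t0 : 2 * pi * (j%:R - k%:R) != 0 :> R.
    by rewrite mulf_neq0 ?pi2_neq0// subr_eq0 eqr_nat.
  apply: (near_cvg _ (eq_n _ (- (2 * pi * (j%:R - k%:R) * d)) t0)); near=> N.
  by apply: eq_avg => i h _ _; congr cos; ring.
have H : m%:R^-1 * (\sum_(j < m) \sum_(k < m) A N j k) @[N --> \oo] -->
    m%:R^-1 * (\sum_(j < m) \sum_(k < m) (j == k)%:R : R).
  apply: cvgMr; apply: cvg_big => [|j _]; first exact: add_continuous.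
  by apply: cvg_big => [|k _]; first exact: add_continuous.
have E : m%:R^-1 * (\sum_(j < m) \sum_(k < m) (j == k)%:R : R) = 1.
  under eq_bigr => j _.
    rewrite (bigD1 j)//= eqxx big1 ?addr0; last first.
      by move=> s /negbTE; rewrite eq_sym => ->.
    over.
  by rewrite sumr_const card_ord mulVf// pnatr_eq0 -lt0n.
rewrite E in H; apply: (near_cvg _ H); near=> N.
under [in RHS]eq_avg do rewrite fejerE.
rewrite avgZ; congr (_ * _).
rewrite (avg_sum _ _ m (fun j i h => \sum_(k < m) cos (2 * pi * (j%:R - k%:R) * (a (n N i + h)%:R - d)))).
apply: eq_bigr => j _.
by rewrite (avg_sum _ _ m (fun k i h => cos (2 * pi * (j%:R - k%:R) * (a (n N i + h)%:R - d)))).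
Unshelve. all: by end_near.
Qed.

(** The frequencies j - k + t and j - k - t occurring in the product are nonzero
    because t is not an integer. *)
Lemma cvg_avg_fejer_cos (R : realType) (a : R -> R) J n (m : nat) (d t : R) :
  0 < t < 1 -> equidistributing_windows a J n ->
  avg (J N) (window N) (fun i h => fejer m (a (n N i + h)%:R - d) *
    cos (2 * pi * t * a (n N i + h)%:R)) @[N --> \oo] --> (0 : R).
Proof.
move=> /andP[t0 t1] [J0 _ eq_n].
pose F (j k : nat) (y : R) :=
  1 / 2 * (cos (2 * pi * (j%:R - k%:R + t) * y - 2 * pi * (j%:R - k%:R) * d)
         + cos (2 * pi * (j%:R - k%:R - t) * y - 2 * pi * (j%:R - k%:R) * d)).
pose A N (j k : nat) := avg (J N) (window N) (fun i h => F j k (a (n N i + h)%:R)).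
have nz (j k : nat) (u : R) : 0 < `|u| < 1 -> 2 * pi * (j%:R - k%:R + u) != 0.
  move=> /andP[u0 u1]; rewrite mulf_neq0 ?pi2_neq0//; apply/eqP => E.
  have uE : u = (k%:Z - j%:Z)%:~R by rewrite intrB; lra.
  move: u0 u1; rewrite uE -intr_norm -[0]/(0%:~R) -[1]/(1%:~R) !ltr_int; lia.
have lim (j k : 'I_m) : A N j k @[N --> \oo] --> (0 : R).
  have t01 : 0 < `|t| < 1 by rewrite gtr0_norm// t0.
  have t01' : 0 < `|- t| < 1 by rewrite normrN gtr0_norm// t0.
  have h1 := eq_n _ (- (2 * pi * (j%:R - k%:R) * d)) (nz j k _ t01).
  have h2 := eq_n _ (- (2 * pi * (j%:R - k%:R) * d)) (nz j k _ t01').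
  have H : 1 / 2 * (avg (J N) (window N) (fun i h => cos (2 * pi * (j%:R - k%:R + t) *
       a (n N i + h)%:R + - (2 * pi * (j%:R - k%:R) * d))) +
     avg (J N) (window N) (fun i h => cos (2 * pi * (j%:R - k%:R - t) *
       a (n N i + h)%:R + - (2 * pi * (j%:R - k%:R) * d)))) @[N --> \oo] --> (1 / 2 * (0 + 0) : R).
    by apply: cvgMr; apply: cvgD.
  rewrite addr0 mulr0 in H; apply: (near_cvg _ H); near=> N.
  by rewrite -avgD -avgZ.
have H : m%:R^-1 * (\sum_(j < m) \sum_(k < m) A N j k) @[N --> \oo] -->
    m%:R^-1 * (\sum_(j < m) \sum_(k < m) 0 : R).
  apply: cvgMr; apply: cvg_big => [|j _]; first exact: add_continuous.
  by apply: cvg_big => [|k _]; first exact: add_continuous.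
rewrite big1 ?mulr0 in H; last by move=> j _; rewrite big1.
apply: (near_cvg _ H); near=> N.
have FE j k y : cos (2 * pi * (j%:R - k%:R) * (y - d)) * cos (2 * pi * t * y) = F j k y.
  by rewrite cosM /F; congr (_ * (cos _ + cos _)); ring.
have E i h : fejer m (a (n N i + h)%:R - d) * cos (2 * pi * t * a (n N i + h)%:R) =
    m%:R^-1 * \sum_(j < m) \sum_(k < m) F j k (a (n N i + h)%:R).
  rewrite fejerE -(mulrA m%:R^-1) mulr_suml; congr (_ * _); apply: eq_bigr => j _.
  by rewrite mulr_suml; apply: eq_bigr => k _; exact: FE.
under [in RHS]eq_avg do rewrite E.
rewrite avgZ; congr (_ * _).
rewrite (avg_sum _ _ m (fun j i h => \sum_(k < m) F j k (a (n N i + h)%:R))).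
apply: eq_bigr => j _.
by rewrite (avg_sum _ _ m (fun k i h => F j k (a (n N i + h)%:R))).
Unshelve. all: by end_near.
Qed.

(** * Cosine polynomials supported on the integer parts *)

Lemma continuous_cos_poly (R : realType) (ws : seq (R * int)) : continuous (cos_poly ws).
Proof.
elim: ws => [|p ws IH].
  have -> : cos_poly [::] = (fun=> 0) :> (R -> R) by apply/funext => t; rewrite /cos_poly big_nil.
  by move=> t; exact: cvg_cst.
have -> : cos_poly (p :: ws) = (fun t => p.1 * cos (2 * pi * t * p.2%:~R) + cos_poly ws t).
  by apply/funext => t; rewrite /cos_poly big_cons.
move=> t; apply: cvgD; last exact: IH.
apply: cvgMr; apply: (@continuous_comp _ _ _ (fun t => 2 * pi * t * p.2%:~R) cos).
  by apply: cvgMl; apply: cvgMr; exact: cvg_id.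
exact: continuous_cos.
Qed.

Definition sample_weights (R : realType) (a : R -> R) (m : nat) (d : R)
    (J : nat -> nat) (n : nat -> nat -> nat) (N : nat) : seq (R * int) :=
  [seq (fejer m (a (n N i + h)%:R - d) / (J N * window N)%:R, Num.floor (a (n N i + h)%:R))
     | i <- index_iota 0 (J N), h <- index_iota 0 (window N)].

Lemma sum_sample_weights (R : realType) (a : R -> R) m d J n N (f : int -> R) :
  \sum_(p <- sample_weights a m d J n N) p.1 * f p.2 =
  avg (J N) (window N) (fun i h => fejer m (a (n N i + h)%:R - d) *
    f (Num.floor (a (n N i + h)%:R))).
Proof.
rewrite big_allpairs_dep /avg big_mkord mulr_suml; apply: eq_bigr => i _.
rewrite big_mkord mulr_suml; apply: eq_bigr => h _ /=; exact: mulrAC.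
Qed.

(** For each t the weighted means along the windows are eventually above - e / 2:
    at t = 0 and t = 1 every cosine is 1, and for 0 < t < 1 the mean with a(k) in
    place of its integer part tends to 0, while the replacement costs at most
    4 pi d on the k where the fractional part of a(k) is below 2 d, and little
    elsewhere since the kernel is small there.  Convex combinations then give a
    bound that is uniform in t. *)
Lemma exists_almost_nonneg_cos_poly (R : realType) (a : R -> R) J n (S : set int) (e : R) :
  equidistributing_windows a J n ->
  (exists K, forall k : nat, (K <= k)%N -> S (Num.floor (a k%:R)) /\ Num.floor (a k%:R) != 0) ->
  0 < e ->
  exists ws : seq (R * int), [/\ forall p, p \in ws -> S p.2 /\ p.2 != 0,
    1 / 2 <= \sum_(p <- ws) p.1 & forall t, 0 <= t <= 1 -> - e <= cos_poly ws t].
Proof.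
move=> eqn [K HK] e0; have [J0 nN _] := eqn.
have p0 := pi_gt0 R.
pose e1 := e / 2; have e10 : 0 < e1 by rewrite divr_gt0.
(* The weights have sum at most 2, so the replacement of a(k) by its integer
   part costs at most 8 pi d <= e1 / 3 near the peak of the kernel. *)
pose d : R := Num.min (1 / 4) (e1 / (24 * pi)).
have d0 : 0 < d by rewrite lt_min !divr_gt0// mulr_gt0.
have d4 : d <= 1 / 4 by rewrite ge_min lexx.
have de : 8 * pi * d <= e1 / 3.
  have : d <= e1 / (24 * pi) by rewrite ge_min lexx orbT.
  by rewrite ler_pdivlMr ?mulr_gt0//; lra.
have s0 : 0 < sin (pi * d) ^+ 2.
  by rewrite exprn_gt0// sin_gt0_pi// mulr_gt0//= gtr_pMr// (le_lt_trans d4)//; lra.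
pose m := (Num.truncn (12 / (e1 * sin (pi * d) ^+ 2))).+1.
have mR : (0 : R) < m%:R by rewrite ltr0n.
have me : 4 / (m%:R * sin (pi * d) ^+ 2) <= e1 / 3.
  rewrite ler_pdivrMr; last exact: mulr_gt0 mR s0.
  have : 12 / (e1 * sin (pi * d) ^+ 2) < m%:R by exact: truncnS_gt.
  rewrite ltr_pdivrMr; last exact: mulr_gt0 e10 s0.
  by move: (m%:R : R) (sin (pi * d) ^+ 2) => M s; lra.
pose W := sample_weights a m d J n.
have W1 : \sum_(p <- W N) p.1 @[N --> \oo] --> (1 : R).
  apply: (near_cvg _ (cvg_avg_fejer d (ltn0Sn _ : (0 < m)%N) eqn)); near=> N.
  have := sum_sample_weights a m d J n N (fun=> 1).
  under eq_bigr do rewrite mulr1.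
  by move=> ->; apply: eq_avg => i h _ _; rewrite mulr1.
have W0 N p : p \in W N -> 0 <= p.1.
  by move=> /allpairsP[[i h] /= [_ _ ->]] /=; rewrite divr_ge0 ?fejer_ge0.
have ptw t : 0 <= t <= 1 -> \forall N \near \oo, - e1 <= cos_poly (W N) t.
  move=> /andP[t0 t1].
  have triv : (forall s : int, cos (2 * pi * t * s%:~R) = 1) -> \forall N \near \oo, - e1 <= cos_poly (W N) t.
    move=> c1; near=> N; apply: (@le_trans _ _ 0); first by rewrite oppr_le0 ltW.
    by rewrite /cos_poly big_seq sumr_ge0// => p pW; rewrite c1 mulr1; exact: W0 pW.
  move: t0; rewrite le_eqVlt => /orP[/eqP t0|t0].
    by apply: triv => s; rewrite -t0 mulr0 mul0r cos0.
  move: t1; rewrite le_eqVlt => /orP[/eqP t1|t1].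
    by apply: triv => s; rewrite t1 mulr1 -[_ * _]add0r cosD2piz cos0.
  have t01 : 0 < t < 1 by rewrite t0.
  have lim := cvg_avg_fejer_cos m d t01 eqn.
  near=> N.
  have h1 : `|avg (J N) (window N) (fun i h => fejer m (a (n N i + h)%:R - d) *
    cos (2 * pi * t * a (n N i + h)%:R))| <= e1 / 3.
    by near: N; move/cvgr0Pnorm_le : lim; apply; rewrite divr_gt0.
  have h2 : \sum_(p <- W N) p.1 <= 2.
    by near: N; apply: (cvgr_le _ W1); rewrite ltr1n.
  have trE : cos_poly (W N) t = avg (J N) (window N) (fun i h => fejer m (a (n N i + h)%:R - d) *
    cos (2 * pi * t * (Num.floor (a (n N i + h)%:R))%:~R)).
    exact: (sum_sample_weights a m d J n N (fun s => cos (2 * pi * t * s%:~R))).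
  have sE : \sum_(p <- W N) p.1 = avg (J N) (window N) (fun i h => fejer m (a (n N i + h)%:R - d)).
    have := sum_sample_weights a m d J n N (fun=> 1).
    under eq_bigr do rewrite mulr1.
    by move=> ->; apply: eq_avg => i h _ _; rewrite mulr1.
  have cmp : avg (J N) (window N) (fun i h => fejer m (a (n N i + h)%:R - d) *
      cos (2 * pi * t * a (n N i + h)%:R)) <= cos_poly (W N) t + (4 * pi * d * 2 + e1 / 3).
    apply: (@le_trans _ _ (cos_poly (W N) t + (4 * pi * d * \sum_(p <- W N) p.1 + e1 / 3))); last first.
      by rewrite lerD2l lerD2r ler_pM2l// !mulr_gt0.
    rewrite trE sE -avgZ -(@avg_cst R (J N) (window N) (e1 / 3))// ?window_gt0//.
    rewrite -!avgD; apply: ler_avg => i h _ _.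
    set y := a _; set w := fejer m _.
    have w0 : 0 <= w := fejer_ge0 _ _.
    have /andP[f1 f2] := floor_itv y.
    have [near0|far0] := ltrP (y - (Num.floor y)%:~R) (2 * d).
      have c : cos (2 * pi * t * y) - cos (2 * pi * t * (Num.floor y)%:~R) <= 4 * pi * d.
        rewrite (le_trans (ler_norm _))// (le_trans (cos_lipschitz _ _))//.
        rewrite -mulrBr ger0_norm; last by rewrite !mulr_ge0 ?subr_ge0// ltW.
        have y0 : 0 <= y - (Num.floor y)%:~R by rewrite subr_ge0.
        move: y0 near0; move: (y - _) => v v0 vd.
        have : pi * (t * v) <= pi * (2 * d) by rewrite ler_pM2l//; nra.
        by lra.
      have : w * (cos (2 * pi * t * y) - cos (2 * pi * t * (Num.floor y)%:~R)) <= w * (4 * pi * d).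
        by rewrite ler_wpM2l.
      by rewrite mulrBr; lra.
    have wf : w <= 2 / (m%:R * sin (pi * d) ^+ 2) by exact: fejer_far.
    have c : cos (2 * pi * t * y) - cos (2 * pi * t * (Num.floor y)%:~R) <= 2.
      by have := cos_le1 (2 * pi * t * y); have := cos_geN1 (2 * pi * t * (Num.floor y)%:~R); lra.
    have : w * (cos (2 * pi * t * y) - cos (2 * pi * t * (Num.floor y)%:~R)) <= w * 2.
      by rewrite ler_wpM2l.
    have : 0 <= 4 * pi * d * w by apply: mulr_ge0 => //; apply: ltW; rewrite !mulr_gt0.
    rewrite mulrBr; lra.
  by move: h1; rewrite ler_norml => /andP[h1 _]; lra.
pose valid (ws : seq (R * int)) := [/\ forall p, p \in ws -> [/\ 0 <= p.1, S p.2 & p.2 != 0],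
  1 / 2 <= \sum_(p <- ws) p.1 & \sum_(p <- ws) p.1 <= 2].
have good : \forall N \near \oo, valid (W N).
  near=> N; split.
  - move=> p pW; split; first exact: W0 pW.
      move: pW => /allpairsP[[i h] /= [_ _ ->]] /=; apply: (HK _ _).1.
      rewrite (leq_trans _ (leq_addr _ _))// (leq_trans _ (nN _ _))//.
      by near: N; exact: nbhs_infty_ge.
    move: pW => /allpairsP[[i h] /= [_ _ ->]] /=; apply: (HK _ _).2.
    rewrite (leq_trans _ (leq_addr _ _))// (leq_trans _ (nN _ _))//.
    by near: N; exact: nbhs_infty_ge.
  - by near: N; apply: (cvgr_ge _ W1); lra.
  - by near: N; apply: (cvgr_le _ W1); lra.
(* Membership in C N records, besides the form of g, only the pointwise bound
   that convex combinations inherit; this is all that uniformization needs. *)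
pose C N : set (R -> R) := [set g | exists2 ws, valid ws & g = (fun t => - cos_poly ws t) /\
  forall t, 0 <= t <= 1 -> (forall N', (N <= N')%N -> - e1 <= cos_poly (W N') t) -> g t <= e1].
have cC : convex_chain C.
  split.
  - move=> N f g s [wf vf [-> Hf]] [wg vg [-> Hg]] /andP[s0' s1].
    have [f1 f2 f3] := vf; have [g1 g2 g3] := vg.
    pose ws := [seq (s * p.1, p.2) | p <- wf] ++ [seq ((1 - s) * p.1, p.2) | p <- wg].
    have sumE : \sum_(p <- ws) p.1 = s * \sum_(p <- wf) p.1 + (1 - s) * \sum_(p <- wg) p.1.
      by rewrite big_cat !big_map /= -!mulr_sumr.
    exists ws.
      split.
      - move=> p; rewrite mem_cat => /orP[] /mapP[q qw ->] /=.
          by have [q1 q2 q3] := f1 q qw; split=> //; rewrite mulr_ge0.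
        by have [q1 q2 q3] := g1 q qw; split=> //; rewrite mulr_ge0// subr_ge0.
      - by rewrite sumE; nra.
      - by rewrite sumE; nra.
    split.
      have scal (r t : R) (w : seq (R * int)) :
          \sum_(p <- w) r * p.1 * cos (2 * pi * t * p.2%:~R) = r * cos_poly w t.
        by rewrite /cos_poly mulr_sumr; apply: eq_bigr => p _; rewrite mulrA.
      by apply/funext => t; rewrite {3}/cos_poly big_cat !big_map /= !scal; ring.
    by move=> t t01 Ht; have := Hf t t01 Ht; have := Hg t t01 Ht; nra.
  - move=> N f [ws v [-> Hf]]; exists ws => //; split=> // t t01 Ht.
    by apply: Hf => // N' NN'; apply: Ht; exact: ltnW.
  - move=> N; have [M _ HM] := good.
    pose N' := maxn N M.
    exists (fun t => - cos_poly (W N') t); exists (W N'); first by apply: HM; exact: leq_maxr.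
    split=> // t t01 Ht; rewrite lerNl; apply: Ht; exact: leq_maxl.
have [|||||f [ws [v1 v2 v3] [-> _]] Hf] :=
  @uniform_of_pointwise R R C `[0, 1]%classic 2 e1 e cC (@segment_compact R 0 1).
- by [].
- by move=> f [ws _ [-> _]] t; apply: cvgN; exact: continuous_cos_poly.
- move=> f [ws [v1 v2 v3] [-> _]] t _; rewrite (le_trans _ v3)// /cos_poly -sumrN.
  rewrite big_seq [leRHS]big_seq ler_sum// => p /v1[p1 _ _].
  by rewrite -mulrN -[leRHS]mulr1 ler_wpM2l// lerNl cos_geN1.
- move=> t; rewrite /= in_itv /= => t01; have [M _ HM] := ptw t t01.
  by exists M => f [ws _ [_ Hf]]; apply: Hf.
- by rewrite ltW//= /e1; lra.
exists ws; split=> // [p /v1[]//|t t01].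
by rewrite lerNl ltW//; apply: Hf; rewrite /= in_itv.
Unshelve. all: by end_near.
Qed.

(** * The theorem *)

Unset Implicit Arguments.

(* The function a is defined on the half line (u, +oo), so that a(n) is
   considered only for the n >= 1 with u < n. *)
Theorem theoremC (R : realType) (u : R) (a : R -> R)
  (a_hardy : hardy_union a)
  (a_growth : polynomial_growth a)
  (a_far : forall (p : {poly int}) (c : R),
     `|a x - c * (map_poly (intr : int -> R) p).[x]| @[x --> +oo_R] --> +oo_R) :
  set_of_single_recurrence R
    [set Num.floor (a n%:R) | n in [set n : nat | (0 < n)%N /\ u < n%:R]].
Proof.
move=> dX X mu T Ti sysT A mA muA.
have [J [n eq_n]] := exists_equidistributing_windows a_hardy a_growth a_far.
set S := [set Num.floor _ | _ in _].
have fA : mu A \is a fin_num by exact: fin_num_measure.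
have A0 : 0 < fine (mu A) by rewrite -lte_fin fineK.
(* As |a| tends to infinity, the integer parts are nonzero for large k. *)
have late : exists K, forall k : nat, (K <= k)%N ->
    S (Num.floor (a k%:R)) /\ Num.floor (a k%:R) != 0.
  have big : \forall x \near +oo_R, 1 <= `|a x|.
    have := a_far 0 0; under eq_fun do rewrite mul0r subr0.
    by move/cvgryPge; apply.
  have [Y HY] := (near_pinftyP _).1 big.
  exists (Num.truncn (Num.max Y (Num.max u 0))).+1 => k Kk.
  have : Num.max Y (Num.max u 0) < k%:R.
    by rewrite (lt_le_trans (truncnS_gt _))// ler_nat.
  rewrite !gt_max => /and3P[Yk uk k0]; split; first by exists k => //; rewrite ltr0n in k0.
  apply/eqP => f0; have := HY k%:R (ltW Yk).
  have /andP[] := floor_itv (a k%:R); rewrite f0 add0r /= => a0 a1.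
  by rewrite ger0_norm// leNgt a1.
have [|ws [wsS W lo]] := @exists_almost_nonneg_cos_poly R a J n S (fine (mu A) / 8) eq_n late _.
  by rewrite divr_gt0.
have [||p pws rec] := @recurrence_of_cos_poly R dX X mu T Ti A ws (fine (mu A) / 8) sysT mA W _ lo.
- by rewrite divr_ge0// ltW.
- by rewrite -[ltRHS]fineK// lte_fin; lra.
by have [Sp p0] := wsS p pws; exists p.2; split.
Qed.
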